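(* Let $K\subset\mathbb{R}^n$ be a proper cone. (i) The discrete-time joint spectral radius $\mathcal{M}\mapsto\rho(\mathcal{S}(\mathcal{M},\mathbb{N}))$ is locally Lipschitz continuous on $\mathcal{P}_\mathbb{N}=\{\mathcal{M}\subset\pi(K):\mathcal{M}\text{ compact, nonempty, and }\operatorname{conv}\mathcal{M}\text{ contains a }K\text{-irreducible element}\}$ endowed with the Hausdorff metric. (ii) The continuous-time joint spectral radius $\mathcal{M}\mapsto\rho(\mathcal{S}(\mathcal{M},\mathbb{R}_+))$ is locally Lipschitz continuous on $\mathcal{P}_{\mathbb{R}_+}=\{\mathcal{M}\subset\pi_{\exp}(K):\mathcal{M}\text{ compact, nonempty, and }\mathcal{S}(\mathcal{M},\mathbb{R}_+)\text{ is }K\text{-irreducible}\}$ endowed with the Hausdorff metric.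
   Context: A proper cone $K\subset\mathbb{R}^n$ is a nonempty set with $rK\subset K$ for all $r>0$ which is convex, pointed, closed and has nonempty interior. Write $x\ge_K y$ if $x-y\in K$. A face of $K$ is a cone $F\subseteq K$ with: $x\in F$, $x\ge_K y\ge_K0$ imply $y\in F$; $\{0\},K$ are trivial. $\pi(K)=\{A: AK\subset K\}$, $\pi_{\exp}(K)=\{A:e^{At}K\subset K\ \forall t\ge0\}$; $A\in\pi(K)$ is $K$-irreducible if no nontrivial face $F$ has $AF\subset F$. Discrete semigroup $\mathcal{S}(\mathcal{M},\mathbb{N})=\bigcup_{t\in\mathbb{N}}\mathcal{S}_t$, $\mathcal{S}_0=\{I\}$, $\mathcal{S}_t=\{A_{t-1}\cdots A_0:A_s\in\mathcal{M}\}$. Continuous semigroup $\mathcal{S}(\mathcal{M},\mathbb{R}_+)=\bigcup_{t\ge0}\mathcal{S}_t$, $\mathcal{S}_t=\{\Phi_\sigma(t):\sigma:[0,t]\to\mathcal{M}\text{ measurable}\}$, $\dot\Phi_\sigma=\sigma\Phi_\sigma$, $\Phi_\sigma(0)=I$. A semigroup $\mathcal{S}\subset\pi(K)$ is $K$-irreducible if for some $t>0$, $\operatorname{conv}\mathcal{S}_t$ contains a $K$-irreducible element. Joint spectral radius $\rho(\mathcal{S})=\lim_{t\to\infty}\sup\{\|S\|:S\in\mathcal{S}_t\}^{1/t}$. Hausdorff metric $H(\mathcal{M},\mathcal{N})=\max\{\max_{A\in\mathcal{M}}\min_{B\in\mathcal{N}}\|A-B\|,\max_{B\in\mathcal{N}}\min_{A\in\mathcal{M}}\|A-B\|\}$.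 Locally Lipschitz: every point has a neighbourhood on which the map is Lipschitz. *)

(* Defs.v *)
From Stdlib Require Import Reals ClassicalEpsilon Factorial.
From mathcomp Require Import ssreflect ssrfun ssrbool eqtype ssrnat seq fintype bigop.
Set Implicit Arguments. Unset Strict Implicit. Unset Printing Implicit Defensive.
Open Scope R_scope.

Definition vec (n : nat) := 'I_n -> R.
Definition mat (n : nat) := 'I_n -> 'I_n -> R.

Definition vzero n : vec n := fun _ => 0.
Definition vadd n (x y : vec n) : vec n := fun i => x i + y i.
Definition vopp n (x : vec n) : vec n := fun i => - x i.
Definition vscale n (r : R) (x : vec n) : vec n := fun i => r * x i.
Definition vnorm n (x : vec n) : R := \big[Rmax/0]_(i < n) Rabs (x i).

Definition mzero n : mat n := fun _ _ => 0.
Definition mid n : mat n := fun i j => if i == j then 1 else 0.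
Definition madd n (A B : mat n) : mat n := fun i j => A i j + B i j.
Definition mopp n (A : mat n) : mat n := fun i j => - A i j.
Definition mscale n (r : R) (A : mat n) : mat n := fun i j => r * A i j.
Definition mmul n (A B : mat n) : mat n :=
  fun i j => \big[Rplus/0]_(k < n) (A i k * B k j).
Definition mapply n (A : mat n) (x : vec n) : vec n :=
  fun i => \big[Rplus/0]_(k < n) (A i k * x k).
(* a matrix norm (max-entry norm; all norms are equivalent) *)
Definition mnorm n (A : mat n) : R :=
  \big[Rmax/0]_(i < n) \big[Rmax/0]_(j < n) Rabs (A i j).
Definition mdist n (A B : mat n) : R := mnorm (madd A (mopp B)).

Fixpoint mpow n (A : mat n) (k : nat) : mat n :=
  match k with O => @mid n | S k' => mmul A (mpow A k') end.
Definition mexp n (A : mat n) : mat n := fun i j =>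
  epsilon (inhabits 0)
    (fun l => Un_cv (fun N => sum_f_R0 (fun k => mpow A k i j / INR (fact k)) N) l).

Definition Rsup (E : R -> Prop) : R := epsilon (inhabits 0) (fun l => is_lub E l).
Definition Rinf (E : R -> Prop) : R := - Rsup (fun x => E (- x)).

Definition is_cone n (K : vec n -> Prop) : Prop :=
  (exists x, K x) /\ (forall r x, 0 < r -> K x -> K (vscale r x)).
Definition convex_set n (K : vec n -> Prop) : Prop :=
  forall x y t, K x -> K y -> 0 <= t <= 1 ->
    K (vadd (vscale t x) (vscale (1 - t) y)).
Definition pointed n (K : vec n -> Prop) : Prop :=
  forall x, K x -> K (vopp x) -> x = @vzero n.
Definition closed_set n (K : vec n -> Prop) : Prop :=
  forall x, (forall eps, 0 < eps -> exists y, K y /\ vnorm (vadd x (vopp y)) < eps) -> K x.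
Definition nonempty_interior n (K : vec n -> Prop) : Prop :=
  exists x eps, 0 < eps /\ forall y, vnorm (vadd y (vopp x)) < eps -> K y.
Definition proper_cone n (K : vec n -> Prop) : Prop :=
  is_cone K /\ convex_set K /\ pointed K /\ closed_set K /\ nonempty_interior K.

Definition Kge n (K : vec n -> Prop) (x y : vec n) : Prop := K (vadd x (vopp y)).

Definition is_face n (K F : vec n -> Prop) : Prop :=
  is_cone F /\ convex_set F /\ (forall x, F x -> K x) /\
  (forall x y, F x -> Kge K x y -> Kge K y (@vzero n) -> F y).
Definition nontrivial_face n (K F : vec n -> Prop) : Prop :=
  is_face K F /\ (exists x, F x /\ x <> @vzero n) /\ (exists x, K x /\ ~ F x).

Definition in_pi n (K : vec n -> Prop) (A : mat n) : Prop :=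
  forall x, K x -> K (mapply A x).
Definition in_pi_exp n (K : vec n -> Prop) (A : mat n) : Prop :=
  forall t, 0 <= t -> in_pi K (mexp (mscale t A)).
Definition K_irreducible n (K : vec n -> Prop) (A : mat n) : Prop :=
  in_pi K A /\
  ~ (exists F, nontrivial_face K F /\ forall x, F x -> F (mapply A x)).

Fixpoint mcomb n (l : seq (R * mat n)) : mat n :=
  match l with nil => @mzero n | (c, A) :: l' => madd (mscale c A) (mcomb l') end.
Fixpoint wsum n (l : seq (R * mat n)) : R :=
  match l with nil => 0 | (c, _) :: l' => c + wsum l' end.
Definition mconv n (M : mat n -> Prop) : mat n -> Prop := fun B =>
  exists l : seq (R * mat n),
    (forall p, List.In p l -> 0 <= fst p /\ M (snd p)) /\ wsum l = 1 /\ B = mcomb l.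
Definition mcompact n (M : mat n -> Prop) : Prop :=
  (exists C, forall A, M A -> mnorm A <= C) /\
  (forall A, (forall eps, 0 < eps -> exists B, M B /\ mdist A B < eps) -> M A).
Definition hausdorff n (M N : mat n -> Prop) : R :=
  Rmax (Rsup (fun r => exists A, M A /\ r = Rinf (fun s => exists B, N B /\ s = mdist A B)))
       (Rsup (fun r => exists B, N B /\ r = Rinf (fun s => exists A, M A /\ s = mdist A B))).

Fixpoint disc_St n (M : mat n -> Prop) (t : nat) : mat n -> Prop :=
  match t with
  | O => fun B => B = @mid n
  | S t' => fun B => exists A P, M A /\ disc_St M t' P /\ B = mmul A P
  end.

Definition null_set (E : R -> Prop) : Prop :=
  forall eps, 0 < eps -> exists a b : nat -> R,
    (forall x, E x -> exists k, a k < x < b k) /\ (forall k, a k <= b k) /\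
    (forall N, sum_f_R0 (fun k => b k - a k) N <= eps).
Definition abs_cont_on n (Phi : R -> mat n) (t : R) : Prop :=
  forall eps, 0 < eps -> exists delta, 0 < delta /\
    forall (m : nat) (a b : nat -> R),
      (forall k, (k < m)%nat -> 0 <= a k /\ a k <= b k /\ b k <= t) ->
      (forall k, (k.+1 < m)%nat -> b k <= a k.+1) ->
      \big[Rplus/0]_(k < m) (b k - a k) < delta ->
      \big[Rplus/0]_(k < m) mdist (Phi (b k)) (Phi (a k)) < eps.
Definition mderiv_at n (Phi : R -> mat n) (s : R) (D : mat n) : Prop :=
  forall i j, derivable_pt_lim (fun u => Phi u i j) s (D i j).
(* continuous: S_t = { Phi_sigma(t) : sigma : [0,t] -> M }, Phi_sigma the
   (Caratheodory) solution of dPhi/ds = sigma(s) Phi(s), Phi(0) = I *)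
Definition cont_St n (M : mat n -> Prop) (t : R) : mat n -> Prop := fun B =>
  exists sigma Phi : R -> mat n,
    (forall s, 0 <= s <= t -> M (sigma s)) /\
    Phi 0 = @mid n /\ abs_cont_on Phi t /\
    null_set (fun s => 0 < s < t /\ ~ mderiv_at Phi s (mmul (sigma s) (Phi s))) /\
    B = Phi t.

Definition root_t (x t : R) : R := if Rlt_dec 0 x then Rpower x (/ t) else 0.
Definition sup_norm n (S : mat n -> Prop) : R :=
  Rsup (fun r => exists A, S A /\ r = mnorm A).
Definition jsr_disc n (M : mat n -> Prop) : R :=
  epsilon (inhabits 0)
    (fun r => Un_cv (fun t => root_t (sup_norm (disc_St M t)) (INR t)) r).
Definition jsr_cont n (M : mat n -> Prop) : R :=
  epsilon (inhabits 0)
    (fun r => forall eps, 0 < eps -> exists T, forall t, T <= t ->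
       Rabs (root_t (sup_norm (cont_St M t)) t - r) < eps).

Definition P_disc n (K : vec n -> Prop) (M : mat n -> Prop) : Prop :=
  (forall A, M A -> in_pi K A) /\ mcompact M /\ (exists A, M A) /\
  (exists B, mconv M B /\ K_irreducible K B).
Definition P_cont n (K : vec n -> Prop) (M : mat n -> Prop) : Prop :=
  (forall A, M A -> in_pi_exp K A) /\ mcompact M /\ (exists A, M A) /\
  (exists t, 0 < t /\ exists B, mconv (cont_St M t) B /\ K_irreducible K B).

Definition loc_lipschitz n (P : (mat n -> Prop) -> Prop) (f : (mat n -> Prop) -> R) : Prop :=
  forall M, P M -> exists delta L, 0 < delta /\ 0 <= L /\
    forall N1 N2, P N1 -> P N2 -> hausdorff M N1 < delta -> hausdorff M N2 < delta ->
      Rabs (f N1 - f N2) <= L * hausdorff N1 N2.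

(* Main.v *)
(** The growth of a positive semigroup is uniform near an irreducible one.  If [B] is
    [K]-irreducible, then [I + B + ... + B^m] maps every unit vector of [K] above
    [a e], with [e] an order unit, and this persists with [a / 2] for [B'] near [B].
    Hence for positive [S], [T] of lengths [s], [t] the vector [S (I + ... + B'^m) T e]
    dominates a multiple of [|T e| S e], so that for any growth rate [r] the number
    [beta = sup |X e| / r^t] satisfies [beta^2 <= C beta]: a bound [|X| <= G r^t] holds
    with [G] independent of the set of matrices near the given one.  Expanding products
    of perturbed matrices then yields [rho(N1) <= rho(N2) + G h].

    In continuous time, the distance from a Caratheodory solution to the products of
    exponentials [exp(h_k A_k)] with [A_k] in [M], suitably discounted, is absolutely
    continuous with nonpositive slope almost everywhere, hence zero.  The time-[t]
    products form a set of positive matrices depending in a Lipschitz way on [M], to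
    which the discrete case applies; the continuous radius is the [1/t]-th power of the
    discrete one, which is bounded away from [0]. *)

From HB Require Import structures.
Require Import Defs.
From Stdlib Require Import Reals Lra ClassicalEpsilon Factorial.
From Stdlib Require Import FunctionalExtensionality PropExtensionality.
From Coquelicot Require Import Coquelicot.
From mathcomp Require Import ssreflect ssrfun ssrbool eqtype ssrnat seq fintype bigop.
From mathcomp Require Import zify.
Set Implicit Arguments. Unset Strict Implicit. Unset Printing Implicit Defensive.
Open Scope R_scope.

Declare Scope vec_scope.
Delimit Scope vec_scope with V.
Bind Scope vec_scope with vec.
Declare Scope mat_scope.
Delimit Scope mat_scope with M.
Bind Scope mat_scope with mat.

Arguments vadd {n} (x y)%_V.
Arguments vopp {n} x%_V.
Arguments vscale {n} r%_R x%_V.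
Arguments vnorm {n} x%_V.
Arguments madd {n} (A B)%_M.
Arguments mopp {n} A%_M.
Arguments mscale {n} r%_R A%_M.
Arguments mmul {n} (A B)%_M.
Arguments mapply {n} A%_M x%_V.
Arguments mexp {n} A%_M.
Arguments Kge {n} K (x y)%_V.

Local Notation "0" := (@vzero _) : vec_scope.
Local Notation "x + y" := (vadd x y) : vec_scope.
Local Notation "- x" := (vopp x) : vec_scope.
Local Notation "x - y" := (vadd x (vopp y)) : vec_scope.
Local Notation "r *: x" := (vscale r x) (at level 40) : vec_scope.
Local Notation "A *v x" := (mapply A x) (at level 40, left associativity) : vec_scope.
Local Notation "0" := (@mzero _) : mat_scope.
Local Notation "1" := (@mid _) : mat_scope.
Local Notation "A + B" := (madd A B) : mat_scope.
Local Notation "- A" := (mopp A) : mat_scope.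
Local Notation "A - B" := (madd A (mopp B)) : mat_scope.
Local Notation "r *: A" := (mscale r A) : mat_scope.
Local Notation "A * B" := (mmul A B) : mat_scope.
Local Notation "x >=[ K ] y" := (Kge K x y) (at level 70, no associativity).
Local Notation "\rsum_ ( i < n ) F" := (\big[Rplus/0]_(i < n) F)
  (at level 41, F at level 41, i, n at level 50).

(** * Sums and maxima of real numbers *)

Lemma exp_ge0 x : 0 <= exp x. Proof. exact: Rlt_le (exp_pos x). Qed.

Lemma Rinv_ge0 x : 0 < x -> 0 <= / x.
Proof. by move=> x_gt0; apply: Rlt_le; exact: Rinv_0_lt_compat. Qed.

#[local] Hint Resolve pos_INR exp_ge0 : core.

HB.instance Definition _ := Monoid.isComLaw.Build R 0 Rplus
  (fun x y z => esym (Rplus_assoc x y z)) Rplus_comm Rplus_0_l.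
HB.instance Definition _ := Monoid.isMulLaw.Build R 0 Rmult Rmult_0_l Rmult_0_r.
HB.instance Definition _ := Monoid.isAddLaw.Build R Rmult Rplus
  Rmult_plus_distr_r (fun x y z => Rmult_plus_distr_l x y z).

Lemma rsum_le n (F G : 'I_n -> R) :
  (forall i, F i <= G i) -> \rsum_(i < n) F i <= \rsum_(i < n) G i.
Proof. by move=> FG; elim/big_ind2: _ => // *; lra. Qed.

Lemma rsum_const n (r : R) : \rsum_(i < n) r = INR n * r.
Proof. by elim: n => [|n IH]; rewrite ?big_ord0 ?big_ord_recr ?IH ?S_INR /=; lra. Qed.

Lemma Rabs_rsum n (F : 'I_n -> R) :
  Rabs (\rsum_(i < n) F i) <= \rsum_(i < n) Rabs (F i).
Proof.
elim/big_ind2: _ => [|x1 x2 y1 y2 *|i _]; [by rewrite Rabs_R0; lra| |lra].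
by apply: Rle_trans (Rabs_triang _ _) _; lra.
Qed.

Lemma le_rsum n (F : 'I_n -> R) j : (forall i, 0 <= F i) -> F j <= \rsum_(i < n) F i.
Proof.
move=> F_ge0; rewrite (bigD1 j) //= -[X in X <= _]Rplus_0_r; apply: Rplus_le_compat_l.
by elim/big_ind: _ => // *; lra.
Qed.

Lemma rsum_delta n (i : 'I_n) (F : 'I_n -> R) :
  \rsum_(k < n) ((if i == k then 1 else 0) * F k) = F i.
Proof.
rewrite (bigD1 i) //= eqxx big1 ?Rplus_0_r ?Rmult_1_l // => k.
by rewrite eq_sym => /negbTE ->; rewrite Rmult_0_l.
Qed.

Section Bigmax.
Variable I : finType.
Implicit Type F : I -> R.

Lemma le_bigRmax F i : F i <= \big[Rmax/0]_j F j.
Proof.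
have : i \in index_enum I by rewrite mem_index_enum.
elim: (index_enum I) => // j s IH; rewrite inE big_cons => /orP[/eqP->|/IH Fi_le].
  exact: Rmax_l.
exact: Rle_trans Fi_le (Rmax_r _ _).
Qed.

Lemma bigRmax_ge0 F : 0 <= \big[Rmax/0]_j F j.
Proof.
elim: (index_enum I) => [|j s IH]; rewrite ?big_nil ?big_cons; first lra.
exact: Rle_trans IH (Rmax_r _ _).
Qed.

Lemma bigRmax_le F b : 0 <= b -> (forall i, F i <= b) -> \big[Rmax/0]_j F j <= b.
Proof. by move=> b_ge0 Fb; elim/big_ind: _ => // x y; exact: Rmax_lub. Qed.

End Bigmax.

(** * Vectors, matrices and the operator norm *)

Ltac vring := apply: functional_extensionality => ?; rewrite /vadd /vopp /vscale /vzero; ring.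
Ltac vfield := apply: functional_extensionality => ?; rewrite /vadd /vopp /vscale /vzero; field.
Ltac mring := do 2 apply: functional_extensionality => ?;
  rewrite /madd /mopp /mscale /mzero; ring.

Section VectorNorm.
Variable n : nat.
Implicit Types x y : vec n.

Lemma vnorm_ge0 x : 0 <= vnorm x. Proof. exact: bigRmax_ge0. Qed.

Lemma Rabs_coord_le x i : Rabs (x i) <= vnorm x.
Proof. exact: (le_bigRmax (fun i => Rabs (x i))). Qed.

Lemma vnorm_le x b : 0 <= b -> (forall i, Rabs (x i) <= b) -> vnorm x <= b.
Proof. exact: bigRmax_le. Qed.

Lemma vnorm_triangle x y : vnorm (x + y) <= vnorm x + vnorm y.
Proof.
apply: vnorm_le => [|i]; first by have := vnorm_ge0 x; have := vnorm_ge0 y; lra.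
apply: Rle_trans (Rabs_triang _ _) _.
by have := Rabs_coord_le x i; have := Rabs_coord_le y i; lra.
Qed.

Lemma vnormZ r x : vnorm (r *: x) = Rabs r * vnorm x.
Proof.
rewrite /vnorm (big_morph _ (fun p q => esym (RmaxRmult p q _ (Rabs_pos r))) (Rmult_0_r _)).
by apply: eq_bigr => i _; exact: Rabs_mult.
Qed.

Lemma vnormZ_ge0 r x : 0 <= r -> vnorm (r *: x) = r * vnorm x.
Proof. by move=> r_ge0; rewrite vnormZ Rabs_pos_eq. Qed.

Lemma vnormN x : vnorm (- x) = vnorm x.
Proof. by apply: eq_bigr => i _; rewrite Rabs_Ropp. Qed.

Lemma vnorm_subC x y : vnorm (x - y) = vnorm (y - x).
Proof. by rewrite -vnormN; congr vnorm; vring. Qed.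

Lemma vnorm0 : vnorm (0 : vec n) = 0.
Proof. by rewrite (_ : 0%V = (0 *: 0)%V) ?vnormZ ?Rabs_R0 ?Rmult_0_l //; vring. Qed.

Lemma vnorm_eq0 x : vnorm x = 0 -> x = 0%V.
Proof.
move=> x_eq0; apply: functional_extensionality => i; have := Rabs_coord_le x i.
by case: (Req_dec (x i) 0) => // /Rabs_pos_lt; lra.
Qed.

Lemma vnorm_gt0 x : x <> 0%V -> 0 < vnorm x.
Proof. by move=> x_neq0; case: (vnorm_ge0 x) => // /esym/vnorm_eq0. Qed.

Lemma vnorm_normalize x : x <> 0%V -> vnorm (/ vnorm x *: x) = 1.
Proof.
move=> /vnorm_gt0 x_gt0; rewrite vnormZ_ge0; first by field; lra.
exact: Rinv_ge0.
Qed.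

End VectorNorm.

#[local] Hint Resolve vnorm_ge0 : core.

Section MatrixAlgebra.
Variable n : nat.
Implicit Types (A B X : mat n) (x y : vec n).

Lemma mapply1 x : (1 *v x)%V = x.
Proof. by apply: functional_extensionality => i; rewrite /mapply /mid rsum_delta. Qed.

Lemma mapply0 x : (0 *v x)%V = 0%V.
Proof. by apply: functional_extensionality => i; apply: big1 => k _; exact: Rmult_0_l. Qed.

Lemma mapplyM A B x : ((A * B) *v x)%V = (A *v (B *v x))%V.
Proof.
apply: functional_extensionality => i; rewrite /mapply /mmul.
under [RHS]eq_bigr => k _ do rewrite big_distrr.
rewrite [RHS]exchange_big /=; apply: eq_bigr => l _.
by rewrite Rmult_comm big_distrr; apply: eq_bigr => k _ /=; ring.
Qed.

Lemma mapplyDl A B x : ((A + B) *v x)%V = (A *v x + B *v x)%V.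
Proof.
apply: functional_extensionality => i; rewrite /mapply /vadd -big_split.
by apply: eq_bigr => k _; rewrite /madd /=; ring.
Qed.

Lemma mapplyDr A x y : (A *v (x + y))%V = (A *v x + A *v y)%V.
Proof.
apply: functional_extensionality => i; rewrite /mapply /vadd -big_split.
by apply: eq_bigr => k _ /=; ring.
Qed.

Lemma mapplyZl r A x : ((r *: A)%M *v x)%V = (r *: (A *v x))%V.
Proof.
apply: functional_extensionality => i; rewrite /mapply /vscale big_distrr.
by apply: eq_bigr => k _; rewrite /mscale /=; ring.
Qed.

Lemma mapplyZr r A x : (A *v (r *: x))%V = (r *: (A *v x))%V.
Proof.
apply: functional_extensionality => i; rewrite /mapply /vscale big_distrr.
by apply: eq_bigr => k _ /=; ring.
Qed.

Lemma mapplyBl A B x : ((A - B) *v x)%V = (A *v x - B *v x)%V.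
Proof.
rewrite (_ : (- B)%M = ((-1) *: B)%M) ?mapplyDl ?mapplyZl; last by mring.
by vring.
Qed.

Lemma mapplyBr A x y : (A *v (x - y))%V = (A *v x - A *v y)%V.
Proof.
rewrite (_ : (- y)%V = ((-1) *: y)%V) ?mapplyDr ?mapplyZr; last by vring.
by vring.
Qed.

Lemma mapplyv0 A : (A *v 0)%V = 0%V.
Proof. by apply: functional_extensionality => i; apply: big1 => k _; exact: Rmult_0_r. Qed.

Definition vbasis (j : 'I_n) : vec n := fun k => if j == k then 1 else 0.

Lemma mapply_basis A i j : (A *v vbasis j)%V i = A i j.
Proof.
rewrite /mapply -[RHS](rsum_delta j (fun k => A i k)).
by apply: eq_bigr => k _; rewrite /vbasis; ring.
Qed.

Lemma mapply_inj A B : (forall x, A *v x = B *v x)%V -> A = B.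
Proof.
move=> AB; do 2 apply: functional_extensionality => ?.
by rewrite -!mapply_basis AB.
Qed.

Lemma mmulA A B X : (A * (B * X) = A * B * X)%M.
Proof. by apply: mapply_inj => x; rewrite !mapplyM. Qed.

Lemma mmul1m A : (1 * A = A)%M.
Proof. by apply: mapply_inj => x; rewrite mapplyM mapply1. Qed.

Lemma mmulm1 A : (A * 1 = A)%M.
Proof. by apply: mapply_inj => x; rewrite mapplyM mapply1. Qed.

Lemma mmulm0 A : (A * 0 = 0)%M.
Proof. by apply: mapply_inj => x; rewrite mapplyM !mapply0 mapplyv0. Qed.

Lemma mmulBl A B X : ((A - B) * X = A * X - B * X)%M.
Proof. by apply: mapply_inj => x; rewrite mapplyM !mapplyBl !mapplyM. Qed.

Lemma mmulBr A B X : (X * (A - B) = X * A - X * B)%M.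
Proof. by apply: mapply_inj => x; rewrite mapplyM !mapplyBl mapplyBr !mapplyM. Qed.

Lemma mmulZl r A X : ((r *: A) * X = r *: (A * X))%M.
Proof. by apply: mapply_inj => x; rewrite mapplyM !mapplyZl mapplyM. Qed.

Lemma mmulZr r A X : (X * (r *: A) = r *: (X * A))%M.
Proof. by apply: mapply_inj => x; rewrite mapplyM !mapplyZl mapplyZr mapplyM. Qed.

End MatrixAlgebra.

(* The row-sum norm, which is the operator norm subordinate to [vnorm]. *)
Definition opnorm n (A : mat n) : R := \big[Rmax/0]_(i < n) \rsum_(j < n) Rabs (A i j).
Arguments opnorm {n} A%_M.

Section OperatorNorm.
Variable n : nat.
Implicit Types (A B : mat n) (x : vec n).

Lemma opnorm_ge0 A : 0 <= opnorm A. Proof. exact: bigRmax_ge0. Qed.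

Lemma row_sum_le_opnorm A i : \rsum_(j < n) Rabs (A i j) <= opnorm A.
Proof. exact: (le_bigRmax (fun i => \rsum_(j < n) Rabs (A i j))). Qed.

Lemma vnorm_mapply A x : vnorm (A *v x) <= opnorm A * vnorm x.
Proof.
apply: vnorm_le => [|i]; first by apply: Rmult_le_pos => //; exact: opnorm_ge0.
apply: Rle_trans (Rabs_rsum _) _.
apply: Rle_trans (Rmult_le_compat_r _ _ _ (vnorm_ge0 x) (row_sum_le_opnorm A i)).
rewrite big_distrl; apply: rsum_le => k; rewrite Rabs_mult.
by apply: Rmult_le_compat_l; [exact: Rabs_pos|exact: Rabs_coord_le].
Qed.

(* A row sum is attained at the vector of signs of the row. *)
Lemma opnorm_le A b : 0 <= b -> (forall x, vnorm x <= 1 -> vnorm (A *v x) <= b) ->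
  opnorm A <= b.
Proof.
move=> b_ge0 Ab; apply: bigRmax_le => // i.
pose signs : vec n := fun j => if Rle_dec 0 (A i j) then 1 else -1.
have signs_le1 : vnorm signs <= 1.
  apply: vnorm_le => [|j]; first lra.
  by rewrite /signs; case: Rle_dec => ? /=; rewrite ?Rabs_Ropp Rabs_R1; lra.
apply: Rle_trans (Ab _ signs_le1); apply: Rle_trans (Rabs_coord_le _ i).
apply: Rle_trans (Rle_abs _); apply: Req_le; apply: eq_bigr => j _.
by rewrite /signs; case: Rle_dec => Aij /=; [rewrite Rabs_pos_eq|rewrite Rabs_left]; lra.
Qed.

Lemma vnorm_mapply_ball A x : vnorm x <= 1 -> vnorm (A *v x) <= opnorm A.
Proof.
move=> x_le1; apply: Rle_trans (vnorm_mapply _ _) _; rewrite -[X in _ <= X]Rmult_1_r.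
by apply: Rmult_le_compat_l => //; exact: opnorm_ge0.
Qed.

Lemma opnorm_triangle A B : opnorm (A + B) <= opnorm A + opnorm B.
Proof.
have A_ge0 := opnorm_ge0 A; have B_ge0 := opnorm_ge0 B.
apply: opnorm_le => [|x x_le1]; first lra.
rewrite mapplyDl; apply: Rle_trans (vnorm_triangle _ _) _.
by apply: Rplus_le_compat; exact: vnorm_mapply_ball.
Qed.

Lemma opnorm_mul A B : opnorm (A * B) <= opnorm A * opnorm B.
Proof.
have A_ge0 := opnorm_ge0 A; have B_ge0 := opnorm_ge0 B.
apply: opnorm_le => [|x x_le1]; first exact: Rmult_le_pos.
rewrite mapplyM; apply: Rle_trans (vnorm_mapply _ _) _.
by apply: Rmult_le_compat_l => //; exact: vnorm_mapply_ball.
Qed.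

Lemma opnormN A : opnorm (- A) = opnorm A.
Proof. by apply: eq_bigr => i _; apply: eq_bigr => j _; rewrite Rabs_Ropp. Qed.

Lemma opnorm_subC A B : opnorm (A - B) = opnorm (B - A).
Proof. by rewrite -opnormN; congr opnorm; mring. Qed.

Lemma opnormZ r A : opnorm (r *: A) = Rabs r * opnorm A.
Proof.
rewrite /opnorm (big_morph _ (fun p q => esym (RmaxRmult p q _ (Rabs_pos r))) (Rmult_0_r _)).
apply: eq_bigr => i _; rewrite big_distrr.
by apply: eq_bigr => j _; exact: Rabs_mult.
Qed.

Lemma opnorm1_le1 : opnorm (1 : mat n) <= 1.
Proof. by apply: opnorm_le => [|x]; rewrite ?mapply1; lra. Qed.

Lemma opnorm1_ge1 : (0 < n)%N -> 1 <= opnorm (1 : mat n).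
Proof.
move=> n_gt0; pose i := Ordinal n_gt0; apply: Rle_trans (row_sum_le_opnorm _ i).
apply: Rle_trans (le_rsum i (fun j => Rabs_pos _)).
by rewrite /mid eqxx Rabs_R1; lra.
Qed.

Lemma opnorm_sub_triangle B A X : opnorm (A - X) <= opnorm (A - B) + opnorm (B - X).
Proof.
by apply: Rle_trans (opnorm_triangle _ _); apply: Req_le; congr opnorm; mring.
Qed.

Lemma opnorm_le_sub A B : opnorm A <= opnorm B + opnorm (A - B).
Proof.
by apply: Rle_trans (opnorm_triangle _ _); apply: Req_le; congr opnorm; mring.
Qed.

Lemma opnorm_subxx A : opnorm (A - A) = 0.
Proof.
by rewrite (_ : A - A = 0 *: A)%M ?opnormZ ?Rabs_R0 ?Rmult_0_l //; mring.
Qed.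

Lemma Rabs_entry_le_mnorm A i j : Rabs (A i j) <= mnorm A.
Proof.
apply: Rle_trans (le_bigRmax (fun i => \big[Rmax/0]_(j < n) Rabs (A i j)) i).
exact: (le_bigRmax (fun j => Rabs (A i j))).
Qed.

Lemma mnorm_le A b : 0 <= b -> (forall i j, Rabs (A i j) <= b) -> mnorm A <= b.
Proof. by move=> b_ge0 Ab; apply: bigRmax_le => // i; exact: bigRmax_le. Qed.

Lemma mnorm_ge0 A : 0 <= mnorm A. Proof. exact: bigRmax_ge0. Qed.

Lemma mnorm_le_opnorm A : mnorm A <= opnorm A.
Proof.
apply: mnorm_le => [|i j]; first exact: opnorm_ge0.
apply: Rle_trans (row_sum_le_opnorm _ i).
exact: (le_rsum j (fun k => Rabs_pos (A i k))).
Qed.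

Lemma opnorm_le_mnorm A : opnorm A <= INR n * mnorm A.
Proof.
apply: bigRmax_le => [|i]; first by apply: Rmult_le_pos => //; exact: mnorm_ge0.
by rewrite -rsum_const; apply: rsum_le => j; exact: Rabs_entry_le_mnorm.
Qed.

Lemma mdistC A B : mdist A B = mdist B A.
Proof.
apply: eq_bigr => i _; apply: eq_bigr => j _.
by rewrite -Rabs_Ropp; congr Rabs; rewrite /madd /mopp; ring.
Qed.

End OperatorNorm.

#[local] Hint Resolve opnorm_ge0 mnorm_ge0 : core.

(** * Compactness *)

(* Cousin's lemma on the existence of tagged partitions subordinate to a gauge,
   as an induction principle. *)
Lemma Cousin_induction a b (P : R -> Prop) : a <= b -> P a ->
  (forall s, a <= s <= b -> exists d, 0 < d /\ forall x y,
     a <= x <= s -> s <= y <= b -> s - d < x -> y < s + d -> P x -> P y) ->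
  P b.
Proof.
move=> ab Pa step; pose E x := a <= x <= b /\ P x.
have Ea : E a by split; [lra|].
have [||s [s_ub s_least]] := @completeness E; first by exists b => x []; lra.
  by exists a.
have sb : s <= b by apply: s_least => x []; lra.
have [d [d_gt0 extend]] := step s (conj (s_ub _ Ea) sb).
have [x [[xb Px] sx]] : exists x, E x /\ s - d < x.
  apply: NNPP => no_x; suff : s <= s - d by lra.
  by apply: s_least => x Ex; apply: Rnot_lt_le => sx; apply: no_x; exists x.
have xs : x <= s by exact: s_ub.
have [min_b min_s] := (Rmin_l b (s + d / 2), Rmin_r b (s + d / 2)).
have Pmin : P (Rmin b (s + d / 2)).
  by apply: (extend x) => //; [lra|split=> //; apply: Rmin_glb; lra|lra].
case: (Rle_dec b (s + d / 2)) => bs; first by rewrite Rmin_left in Pmin.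
rewrite Rmin_right in Pmin; last lra.
by suff : s + d / 2 <= s; [lra|apply: s_ub; split=> //; lra].
Qed.

(* Compactness of boxes, by Cousin's lemma in one coordinate after the other. *)
Lemma box_uniform_index n (Q : nat -> vec n -> Prop) r :
  (forall j k x, (j <= k)%N -> Q j x -> Q k x) ->
  (forall x, exists eps k, 0 < eps /\ forall y, vnorm (y - x) < eps -> Q k y) ->
  exists k, forall x, vnorm x <= r -> Q k x.
Proof.
move=> Q_mono Q_local.
have slab (s : seq 'I_n) x : exists eps k, 0 < eps /\ forall y : vec n,
    (forall i, i \in s -> Rabs (y i) <= r) ->
    (forall i, i \notin s -> Rabs (y i - x i) < eps) -> Q k y.
  elim: s x => [|i s IH] x.
    have [eps [k [eps_gt0 Qk]]] := Q_local x; exists (eps / 2), k; split; first lra.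
    move=> y _ y_near; apply: Qk; apply: Rle_lt_trans (_ : eps / 2 < _); last lra.
    by apply: vnorm_le => [|j]; [lra|apply: Rlt_le; exact: y_near].
  pose P v := exists eps k, 0 < eps /\ forall y : vec n, - r <= y i <= v ->
    (forall j, j \in s -> Rabs (y j) <= r) ->
    (forall j, j \notin i :: s -> Rabs (y j - x j) < eps) -> Q k y.
  have [r_lt0|r_ge0] := Rlt_le_dec r 0.
    exists 1, 0%N; split; first lra; move=> y /(_ i (mem_head _ _)).
    by have := Rabs_pos (y i); lra.
  suff [eps [k [eps_gt0 Qk]]] : P r.
    exists eps, k; split=> // y y_in y_near; apply: Qk => // [|j js].
      by apply/Rabs_le_between; exact: y_in (mem_head _ _).
    by apply: y_in; rewrite inE js orbT.
  apply: (Cousin_induction (a := - r - 1)); first lra.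
    by exists 1, 0%N; split=> [|y]; lra.
  move=> v _; have [eps [k [eps_gt0 Qk]]] := IH (fun j => if j == i then v else x j).
  exists eps; split=> // a b _ _ va bv [eps' [k' [eps'_gt0 Qk']]].
  exists (Rmin eps eps'), (maxn k k'); split; first exact: Rmin_pos.
  move=> y yi ys y_near; case: (Rle_lt_dec (y i) a) => y_a.
    apply: Q_mono (leq_maxr _ _) _; apply: Qk' => // [|j /y_near]; first lra.
    by move/Rlt_le_trans; apply; exact: Rmin_r.
  apply: Q_mono (leq_maxl _ _) _; apply: Qk => // j js.
  case: eqP => [->|/eqP ji]; first by apply: Rabs_def1; lra.
  by apply: Rlt_le_trans (y_near j _) (Rmin_l _ _); rewrite inE negb_or ji.
have [eps [k [eps_gt0 Qk]]] := slab (enum 'I_n) 0%V.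
exists k => x x_le; apply: Qk => i; last by rewrite mem_enum.
by move=> _; exact: Rle_trans (Rabs_coord_le x i) x_le.
Qed.

(** * Proper cones *)

Section Cone.
Variables (n : nat) (K : vec n -> Prop).
Hypothesis K_proper : proper_cone K.
Implicit Types (x y z e : vec n) (A : mat n).

Lemma cone_closed x :
  (forall eps, 0 < eps -> exists y, K y /\ vnorm (x - y) < eps) -> K x.
Proof. by have [_ [_ [_ [+ _]]]] := K_proper; exact. Qed.

Lemma cone_complement_open x : ~ K x ->
  exists eps, 0 < eps /\ forall y, vnorm (y - x) < eps -> ~ K y.
Proof.
move=> nKx; apply: NNPP => no_eps; apply: nKx; apply: cone_closed => eps eps_gt0.
apply: NNPP => no_y; apply: no_eps; exists eps; split=> // y y_near Ky.
by apply: no_y; exists y; rewrite vnorm_subC.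
Qed.

Lemma cone0 : K 0.
Proof.
have [[[x Kx] Kscale] _] := K_proper; apply: cone_closed => eps eps_gt0.
have x_gt0 : 0 < vnorm x + 1 by have := vnorm_ge0 x; lra.
have r_gt0 : 0 < eps / (vnorm x + 1) by exact: Rdiv_lt_0_compat.
exists (eps / (vnorm x + 1) *: x)%V; split; first exact: Kscale.
rewrite vnorm_subC (_ : _ - 0 = eps / (vnorm x + 1) *: x)%V; last by vring.
rewrite vnormZ_ge0; last lra.
have {2}-> : eps = eps / (vnorm x + 1) * (vnorm x + 1) by field; lra.
by apply: Rmult_lt_compat_l; lra.
Qed.

Lemma coneZ r x : 0 <= r -> K x -> K (r *: x).
Proof.
move=> r_ge0 Kx; case: (Req_dec r 0) => [->|r_neq0].
  by rewrite (_ : 0 *: x = 0)%V; [exact: cone0|vring].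
by have [[_ +] _] := K_proper; apply=> //; lra.
Qed.

Lemma coneD x y : K x -> K y -> K (x + y).
Proof.
move=> Kx Ky; have [_ [K_convex _]] := K_proper.
rewrite (_ : x + y = 2 *: (/ 2 *: x + (1 - / 2) *: y))%V; last by vfield.
by apply: coneZ; [lra|apply: K_convex => //; lra].
Qed.

Lemma Kge_refl x : x >=[K] x.
Proof. by rewrite /Kge (_ : x - x = 0)%V; [exact: cone0|vring]. Qed.

Lemma Kge_trans y x z : x >=[K] y -> y >=[K] z -> x >=[K] z.
Proof. by move=> xy yz; have := coneD xy yz; congr K; vring. Qed.

Lemma KgeD x y x' y' : x >=[K] y -> x' >=[K] y' -> x + x' >=[K] y + y'.
Proof. by move=> xy xy'; have := coneD xy xy'; congr K; vring. Qed.

Lemma KgeZ r x y : 0 <= r -> x >=[K] y -> r *: x >=[K] r *: y.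
Proof. by move=> r_ge0 xy; have := coneZ r_ge0 xy; congr K; vring. Qed.

Lemma KgeZ_le r s x : K x -> r <= s -> s *: x >=[K] r *: x.
Proof. by move=> Kx rs; have : 0 <= s - r by [lra]; move/coneZ/(_ Kx); congr K; vring. Qed.

Lemma Kge0 x : x >=[K] 0 <-> K x.
Proof. by rewrite /Kge (_ : x - 0 = x)%V //; vring. Qed.

Lemma Kge_mapply A x y : in_pi K A -> x >=[K] y -> A *v x >=[K] A *v y.
Proof. by move=> A_pos /A_pos; rewrite mapplyBr. Qed.

Lemma cone_uniform_index (Q : nat -> vec n -> Prop) :
  (forall j k x, (j <= k)%N -> K x -> Q j x -> Q k x) ->
  (forall x, K x -> x <> 0%V ->
    exists eps k, 0 < eps /\ forall y, K y -> vnorm (y - x) < eps -> Q k y) ->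
  exists k, forall x, K x -> vnorm x = 1 -> Q k x.
Proof.
move=> Q_mono Q_local; pose Q' k x := K x -> vnorm x = 1 -> Q k x.
suff [k Qk] : exists k, forall x, vnorm x <= 1 -> Q' k x.
  by exists k => x Kx x1; apply: Qk => //; lra.
apply: box_uniform_index => [j k x jk Qj Kx x1|x]; first exact: Q_mono jk Kx (Qj Kx x1).
case: (classic (K x)) => [Kx|/cone_complement_open[eps [eps_gt0 notK]]]; last first.
  by exists eps, 0%N; split=> // y /notK nKy /nKy.
case: (classic (x = 0%V)) => [->|x_neq0]; last first.
  have [eps [k [eps_gt0 Qk]]] := Q_local x Kx x_neq0.
  by exists eps, k; split=> // y y_near Ky _; exact: Qk.
exists 1, 0%N; split; first lra; move=> y y_near _ y1; move: y_near.
by rewrite (_ : y - 0 = y)%V; [lra|vring].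
Qed.

Definition normality_constant kappa := 0 < kappa /\
  forall x y, K x -> y >=[K] x -> vnorm x <= kappa * vnorm y.

Lemma normality_constant_exists : exists kappa, normality_constant kappa.
Proof.
pose Q k x := forall y, y >=[K] x -> 1 <= INR k.+1 * vnorm y.
have [j k x jk _ Qj|x Kx x_neq0|k Qk] := @cone_uniform_index Q.
- move=> y yx; apply: Rle_trans (Qj y yx) _; apply: Rmult_le_compat_r => //.
  by apply: le_INR; lia.
- have /cone_complement_open[eps [eps_gt0 notK]] : ~ K (- x).
    by have [_ [_ [K_pointed _]]] := K_proper => /(K_pointed x Kx).
  have [k k_gt] := INR_unbounded (2 / eps).
  exists (eps / 2), k; split; first lra; move=> y _ y_near z zy.
  have far : eps <= vnorm (z - y - - x)%V by apply: Rnot_lt_le => /notK; apply.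
  have : vnorm (z - y - - x)%V <= vnorm z + vnorm (y - x)%V.
    rewrite (vnorm_subC y); apply: Rle_trans (vnorm_triangle _ _).
    by apply: Req_le; congr vnorm; vring.
  move=> z_large; have k_ge : 2 / eps <= INR k.+1 by rewrite S_INR; lra.
  have -> : 1 = 2 / eps * (eps / 2) by field; lra.
  apply: Rmult_le_compat => //; try lra.
  by apply: Rlt_le; apply: Rdiv_lt_0_compat; lra.
exists (INR k.+1); split; first by apply: lt_0_INR; lia.
move=> x y Kx yx; case: (classic (x = 0%V)) => [->|x_neq0].
  by rewrite vnorm0; apply: Rmult_le_pos.
have x_gt0 := vnorm_gt0 x_neq0.
have inv_ge0 := Rinv_ge0 x_gt0.
have := Qk _ (coneZ inv_ge0 Kx) (vnorm_normalize x_neq0) _ (KgeZ inv_ge0 yx).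
rewrite vnormZ_ge0 // => /(Rmult_le_compat_l _ _ _ (Rlt_le _ _ x_gt0)).
rewrite Rmult_1_r; congr Rle; field; lra.
Qed.

Definition order_unit e := forall z r, vnorm z <= r -> K (r *: e + z).

Lemma order_unit_exists : exists e, order_unit e.
Proof.
have [_ [_ [_ [_ [x [eps [eps_gt0 ball_x]]]]]]] := K_proper.
exists (2 / eps *: x)%V => z r zr; have z_ge0 := vnorm_ge0 z.
case: (Req_dec r 0) => [r_eq0|r_neq0].
  rewrite r_eq0 (@vnorm_eq0 _ z); last lra.
  by rewrite (_ : _ + 0 = 0)%V; [exact: cone0|vring].
have shrink_gt0 : 0 < eps / (2 * r) by apply: Rdiv_lt_0_compat; lra.
rewrite (_ : _ + z = (2 * r / eps) *: (x + eps / (2 * r) *: z))%V; last by vfield; lra.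
apply: coneZ; first by apply: Rlt_le; apply: Rdiv_lt_0_compat; lra.
apply: ball_x; rewrite (_ : _ - x = eps / (2 * r) *: z)%V; last by vring.
rewrite vnormZ_ge0; last lra.
apply: Rle_lt_trans (_ : eps / (2 * r) * r < eps); first by apply: Rmult_le_compat_l; lra.
by rewrite (_ : eps / (2 * r) * r = eps / 2); [lra|field; lra].
Qed.

Lemma order_unit_cone e : order_unit e -> K e.
Proof. by move/(_ 0%V 1); rewrite vnorm0 => /(_ Rle_0_1); congr K; vring. Qed.

Lemma order_unit_Kge e z r : order_unit e -> vnorm z <= r -> r *: e >=[K] z.
Proof. by move=> e_unit z_le; apply: e_unit; rewrite vnormN. Qed.

Lemma Kge_order_unit_perturb e s d x y : order_unit e ->
  x >=[K] s *: e -> vnorm (x - y) <= d -> y >=[K] (s - d) *: e.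
Proof.
move=> e_unit x_ge xy; have := KgeD x_ge (order_unit_Kge e_unit xy).
by rewrite /Kge; congr K; vring.
Qed.

(* [A] maps the order interval from [- e] to [e], which contains the unit ball,
   into that from [- A e] to [A e]. *)
Lemma opnorm_order_unit A e kappa : in_pi K A -> order_unit e ->
  normality_constant kappa -> opnorm A <= (2 * kappa + 1) * vnorm (A *v e).
Proof.
move=> A_pos e_unit [kappa_gt0 normal]; have Ke := order_unit_cone e_unit.
apply: opnorm_le => [|z z_le1]; first by apply: Rmult_le_pos; [lra|].
have lower : K (A *v e + A *v z).
  by rewrite -mapplyDr; apply: A_pos; have := e_unit z 1 z_le1; congr K; vring.
have upper : 2 *: (A *v e) >=[K] A *v e + A *v z.
  have /A_pos : K (e - z) by have := order_unit_Kge e_unit z_le1; congr K; vring.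
  by rewrite mapplyBr; congr K; vring.
have := normal _ _ lower upper; rewrite vnormZ_ge0; last lra.
have := vnorm_triangle (A *v e + A *v z) (- (A *v e)); rewrite vnormN.
by rewrite (_ : _ + _ - _ = A *v z)%V; [lra|vring].
Qed.

End Cone.

(** * Irreducible matrices *)

Lemma geometric_sumS r m : sum_f_R0 (pow r) m.+1 = 1 + r * sum_f_R0 (pow r) m.
Proof. by elim: m => [|m IH]; [rewrite /=; ring|rewrite tech5 {1}IH tech5 /=; ring]. Qed.

Lemma geometric_sum_ge1 r m : 0 <= r -> 1 <= sum_f_R0 (pow r) m.
Proof.
move=> r_ge0; elim: m => [|m IH]; first by rewrite /=; lra.
by rewrite tech5; have := pow_le r m.+1 r_ge0; lra.
Qed.

Fixpoint neumann_sum n (A : mat n) (m : nat) : mat n :=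
  if m is m'.+1 then (1 + A * neumann_sum A m')%M else 1%M.
Arguments neumann_sum {n} A%_M m.

Lemma mapply_neumann_sumS n (A : mat n) m x :
  (neumann_sum A m.+1 *v x = x + A *v (neumann_sum A m *v x))%V.
Proof. by rewrite /= mapplyDl mapply1 mapplyM. Qed.

Lemma opnorm_neumann_sum n (A : mat n) b m :
  opnorm A <= b -> opnorm (neumann_sum A m) <= sum_f_R0 (pow b) m.
Proof.
move=> A_le; elim: m => [|m IH]; first exact: opnorm1_le1.
rewrite geometric_sumS; apply: Rle_trans (opnorm_triangle _ _) _.
apply: Rplus_le_compat; first exact: opnorm1_le1.
by apply: Rle_trans (opnorm_mul _ _) _; apply: Rmult_le_compat.
Qed.

Lemma neumann_sum_lipschitz n b m : 0 <= b -> exists L, 0 <= L /\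
  forall A B : mat n, opnorm A <= b -> opnorm B <= b ->
  opnorm (neumann_sum A m - neumann_sum B m) <= L * opnorm (A - B).
Proof.
move=> b_ge0; elim: m => [|m [L [L_ge0 IH]]].
  by exists 0; split=> [|A B _ _]; rewrite ?opnorm_subxx; lra.
set s := sum_f_R0 (pow b) m.
have s_ge0 : 0 <= s by have := geometric_sum_ge1 m b_ge0; rewrite -/s; lra.
exists (b * L + s); split; first by have := Rmult_le_pos _ _ b_ge0 L_ge0; lra.
move=> A B A_le B_le.
rewrite (_ : neumann_sum A m.+1 - _ = A * (neumann_sum A m - neumann_sum B m) +
  (A - B) * neumann_sum B m)%M; last by rewrite mmulBr mmulBl /=; mring.
apply: Rle_trans (opnorm_triangle _ _) _; rewrite Rmult_plus_distr_r.
apply: Rplus_le_compat; apply: Rle_trans (opnorm_mul _ _) _.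
  by rewrite Rmult_assoc; apply: Rmult_le_compat => //; exact: IH.
by rewrite Rmult_comm; apply: Rmult_le_compat_r => //; exact: opnorm_neumann_sum.
Qed.

Section Irreducible.
Variables (n : nat) (K : vec n -> Prop).
Hypothesis K_proper : proper_cone K.
Implicit Types (x y z e : vec n) (A B P : mat n).

Lemma in_pi1 : in_pi K 1.
Proof. by move=> x; rewrite mapply1. Qed.

Lemma in_pi_mul A B : in_pi K A -> in_pi K B -> in_pi K (A * B)%M.
Proof. by move=> A_pos B_pos x Kx; rewrite mapplyM; apply: A_pos; exact: B_pos. Qed.

Lemma in_pi_neumann_sum A m : in_pi K A -> in_pi K (neumann_sum A m).
Proof.
move=> A_pos; elim: m => [|m IH] x Kx; first exact: in_pi1.
by rewrite mapply_neumann_sumS; apply: coneD => //; apply: A_pos; exact: IH.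
Qed.

Lemma neumann_sum_mono A j k x : in_pi K A -> K x -> (j <= k)%N ->
  neumann_sum A k *v x >=[K] neumann_sum A j *v x.
Proof.
move=> A_pos Kx; elim: k j => [|k IH] [|j] // jk; try exact: Kge_refl.
  rewrite mapply_neumann_sumS /= mapply1 /Kge (_ : _ - x = A *v (neumann_sum A k *v x))%V.
    exact: A_pos (in_pi_neumann_sum k A_pos Kx).
  by vring.
rewrite !mapply_neumann_sumS; apply: KgeD => //; first exact: Kge_refl.
by apply: Kge_mapply => //; exact: IH.
Qed.

Definition orbit_ideal A x z :=
  K z /\ exists m r, 0 <= r /\ r *: (neumann_sum A m *v x) >=[K] z.

Lemma orbit_ideal_face A x : in_pi K A -> K x -> is_face K (orbit_ideal A x).
Proof.
move=> A_pos Kx; split; [split|split; [|split]].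
- exists 0%V; split; first exact: cone0.
  exists 0%N, 0; split; first lra; rewrite (_ : 0 *: _ = 0)%V; first exact: Kge_refl.
  by vring.
- move=> s z s_gt0 [Kz [m [r [r_ge0 z_le]]]]; have s_ge0 := Rlt_le _ _ s_gt0.
  split; first exact: coneZ.
  exists m, (s * r); split; first exact: Rmult_le_pos.
  by have := KgeZ K_proper s_ge0 z_le; congr Kge; vring.
- move=> y z t [Ky [j [r [r_ge0 y_le]]]] [Kz [k [s [s_ge0 z_le]]]] t01.
  have [t_ge0 t'_ge0] : 0 <= t /\ 0 <= 1 - t by lra.
  split; first by apply: coneD => //; exact: coneZ.
  exists (j + k)%N, (t * r + (1 - t) * s).
  split; first by apply: Rplus_le_le_0_compat; exact: Rmult_le_pos.
  set w := (_ *v x)%V; rewrite (_ : _ *: w = t *: (r *: w) + (1 - t) *: (s *: w))%V.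
    apply: KgeD => //; apply: KgeZ => //.
      by apply: (Kge_trans K_proper) y_le; apply: KgeZ => //; apply: neumann_sum_mono => //; lia.
    by apply: (Kge_trans K_proper) z_le; apply: KgeZ => //; apply: neumann_sum_mono => //; lia.
  by vring.
- by move=> z [].
- move=> z y [Kz [m [r [r_ge0 z_le]]]] yz /Kge0 Ky; split=> //.
  by exists m, r; split=> //; exact: Kge_trans z_le yz.
Qed.

Lemma orbit_ideal_self A x : K x -> orbit_ideal A x x.
Proof.
move=> Kx; split=> //; exists 0%N, 1; split; first lra.
by rewrite /= mapply1 (_ : 1 *: x = x)%V; [exact: Kge_refl|vring].
Qed.

Lemma orbit_ideal_invariant A x z : in_pi K A -> K x ->
  orbit_ideal A x z -> orbit_ideal A x (A *v z).
Proof.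
move=> A_pos Kx [Kz [m [r [r_ge0 z_le]]]]; split; first exact: A_pos.
exists m.+1, r; split=> //; apply: (Kge_trans K_proper) (Kge_mapply A_pos z_le).
rewrite mapplyZr mapply_neumann_sumS; apply: KgeZ => //.
by rewrite /Kge (_ : _ - _ = x)%V //; vring.
Qed.

Lemma irreducible_orbit_ideal A x y : K_irreducible K A -> K x -> x <> 0%V -> K y ->
  orbit_ideal A x y.
Proof.
move=> [A_pos irr] Kx x_neq0 Ky; apply: NNPP => not_y; apply: irr.
exists (orbit_ideal A x); split; last by move=> z; exact: orbit_ideal_invariant.
split; first exact: orbit_ideal_face.
by split; [exists x; split=> //; exact: orbit_ideal_self|exists y].
Qed.

Definition uniformly_positive e r P :=
  forall x, K x -> P *v x >=[K] (r * vnorm x) *: e.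

Lemma uniformly_positive_perturb e r d P P' : order_unit K e ->
  uniformly_positive e r P -> opnorm (P - P') <= d -> uniformly_positive e (r - d) P'.
Proof.
move=> e_unit P_pos PP' x Kx; rewrite Rmult_minus_distr_r.
apply: (Kge_order_unit_perturb K_proper e_unit (P_pos x Kx)).
rewrite -mapplyBl; apply: Rle_trans (vnorm_mapply _ _) _.
exact: Rmult_le_compat_r.
Qed.

Lemma irreducible_locally_positive A e x : K_irreducible K A -> order_unit K e ->
  K x -> x <> 0%V -> exists m s eps, 0 < s /\ 0 < eps /\
    forall y, vnorm (y - x) < eps -> neumann_sum A m *v y >=[K] s *: e.
Proof.
move=> irr e_unit Kx x_neq0; have A_pos := irr.1.
have [_ [m [r [r_ge0 e_le]]]] :=
  irreducible_orbit_ideal irr Kx x_neq0 (order_unit_cone e_unit).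
set P := neumann_sum A m in e_le; set s := / (r + 1).
have s_gt0 : 0 < s by apply: Rinv_0_lt_compat; lra.
have Px_ge : P *v x >=[K] s *: e.
  have r1_ge : (r + 1) *: (P *v x) >=[K] e.
    apply: (Kge_trans K_proper) e_le; apply: KgeZ_le => //; last lra.
    exact: (in_pi_neumann_sum m A_pos).
  by have := KgeZ K_proper (Rlt_le _ _ s_gt0) r1_ge; congr Kge; rewrite /s; vfield; lra.
have P_gt0 : 0 < opnorm P + 1 by have := opnorm_ge0 P; lra.
exists m, (s - s / 2), (s / 2 / (opnorm P + 1)); split; first lra.
split=> [|y yx]; first by apply: Rdiv_lt_0_compat; lra.
apply: (Kge_order_unit_perturb K_proper e_unit Px_ge); rewrite -mapplyBr.
apply: Rle_trans (vnorm_mapply _ _) _; rewrite vnorm_subC.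
have -> : s / 2 = (opnorm P + 1) * (s / 2 / (opnorm P + 1)) by field; lra.
by apply: Rmult_le_compat => //; lra.
Qed.

Lemma irreducible_uniformly_positive A e : K_irreducible K A -> order_unit K e ->
  exists m r, 0 < r /\ uniformly_positive e r (neumann_sum A m).
Proof.
move=> irr e_unit; have A_pos := irr.1; have Ke := order_unit_cone e_unit.
pose Q k x := neumann_sum A k *v x >=[K] (/ INR k.+1) *: e.
have Q_weaken j k x s : (j <= k)%N -> / INR k.+1 <= s -> K x ->
    neumann_sum A j *v x >=[K] s *: e -> Q k x.
  move=> jk ks Kx x_ge; apply: (Kge_trans K_proper (neumann_sum_mono A_pos Kx jk)).
  by apply: (Kge_trans K_proper x_ge); exact: KgeZ_le.
have [j k x jk Kx|x Kx x_neq0|k Qk] := @cone_uniform_index n K K_proper Q.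
- apply: Q_weaken => //; apply: Rinv_le_contravar; first by apply: lt_0_INR; lia.
  by apply: le_INR; lia.
- have [m [s [eps [s_gt0 [eps_gt0 near_x]]]]] :=
    irreducible_locally_positive irr e_unit Kx x_neq0.
  have [N [N_gt N_gt0]] := archimed_cor1 _ s_gt0.
  exists eps, (maxn N m); split=> // y Ky /near_x; apply: Q_weaken => //.
    exact: leq_maxr.
  apply: Rle_trans (_ : / INR N <= _); last lra.
  by apply: Rinv_le_contravar; [apply: lt_0_INR|apply: le_INR]; lia.
exists k, (/ INR k.+1); split; first by apply: Rinv_0_lt_compat; apply: lt_0_INR; lia.
move=> x Kx; case: (classic (x = 0%V)) => [->|x_neq0].
  by rewrite mapplyv0 vnorm0 Rmult_0_r (_ : 0 *: e = 0)%V; [exact: Kge_refl|vring].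
have x_gt0 := vnorm_gt0 x_neq0.
have inv_ge0 := Rinv_ge0 x_gt0.
have := Qk _ (coneZ K_proper inv_ge0 Kx) (vnorm_normalize x_neq0).
move=> /(KgeZ K_proper (Rlt_le _ _ x_gt0)); rewrite mapplyZr.
by congr Kge; vfield; try lra; apply: not_0_INR.
Qed.

End Irreducible.

(** * Discrete semigroups and their growth rates *)

Definition nonempty T (S : T -> Prop) : Prop := exists x, S x.

Section MatrixSets.
Variable n : nat.
Implicit Types (M N S : mat n -> Prop) (A B : mat n).

Definition opnorm_bounded b N := forall A, N A -> opnorm A <= b.

Definition subset_pi (K : vec n -> Prop) N := forall A, N A -> in_pi K A.

Definition within h M N := forall A, M A -> exists B, N B /\ opnorm (A - B) <= h.

Lemma opnorm_bounded_within b h M N :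
  opnorm_bounded b M -> within h N M -> opnorm_bounded (b + h) N.
Proof. by move=> M_le NM A /NM[B [/M_le B_le AB]]; have := opnorm_le_sub A B; lra. Qed.

Lemma mconv_sublinear_le (f : mat n -> R) N B b : f 0%M = 0 ->
  (forall X Y, f (X + Y)%M <= f X + f Y) -> (forall r X, 0 <= r -> f (r *: X)%M <= r * f X) ->
  mconv N B -> (forall A, N A -> f A <= b) -> f B <= b.
Proof.
move=> f0 fD fZ [l [l_in [weight1 ->]]] f_le; rewrite -[b]Rmult_1_l -weight1 {weight1 B}.
elim: l l_in => [|[r A] l IH] l_in /=; first by rewrite f0; lra.
have [/= r_ge0 NA] := l_in (r, A) (or_introl erefl).
rewrite Rmult_plus_distr_r; apply: Rle_trans (fD _ _) _; apply: Rplus_le_compat.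
  by apply: Rle_trans (fZ _ _ r_ge0) _; apply: Rmult_le_compat_l => //; exact: f_le.
by apply: IH => p pl; apply: l_in; right.
Qed.

Lemma mconv_within M N h B : within h M N -> mconv M B ->
  exists B', mconv N B' /\ opnorm (B - B') <= h.
Proof.
move=> MN [l [l_in [weight1 ->]]].
suff [l' [l'_in [weight dist]]] : exists l',
    (forall p, List.In p l' -> 0 <= fst p /\ N (snd p)) /\
    wsum l' = wsum l /\ opnorm (mcomb l - mcomb l') <= wsum l * h.
  exists (mcomb l'); split; first by exists l'; rewrite weight.
  by move: dist; rewrite weight1 Rmult_1_l.
elim: l l_in {weight1} => [|[r A] l IH] l_in.
  by exists [::]; rewrite /= opnorm_subxx; do 2 split=> //; lra.
have [|l' [l'_in [weight dist]]] := IH; first by move=> p pl; apply: l_in; right.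
have [/= r_ge0 /MN[A' [NA' AA']]] := l_in (r, A) (or_introl erefl).
exists ((r, A') :: l'); split; first by move=> p [<-|/l'_in].
rewrite /= weight; split=> //.
rewrite (_ : r *: A + mcomb l - _ = r *: (A - A') + (mcomb l - mcomb l'))%M; last by mring.
apply: Rle_trans (opnorm_triangle _ _) _; rewrite Rmult_plus_distr_r.
apply: Rplus_le_compat => //; rewrite opnormZ Rabs_pos_eq //.
exact: Rmult_le_compat_l.
Qed.

End MatrixSets.

Section DiscreteSemigroup.
Variable n : nat.
Implicit Types (N : mat n -> Prop) (A B X Y : mat n).

Lemma disc_St_mul N s t X Y :
  disc_St N s X -> disc_St N t Y -> disc_St N (s + t) (X * Y)%M.
Proof.
elim: s X => [|s IH] X /=; first by move=> ->; rewrite mmul1m.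
move=> [A [P [NA [NP ->]]]] NY; exists A, (P * Y)%M; split=> //.
by split; [exact: IH|rewrite mmulA].
Qed.

Lemma disc_St_split N s t X : disc_St N (s + t) X ->
  exists Y Z, disc_St N s Y /\ disc_St N t Z /\ X = (Y * Z)%M.
Proof.
elim: s X => [|s IH] X /=.
  by rewrite add0n => NX; exists 1%M, X; rewrite mmul1m.
move=> [A [P [NA [/IH[Y [Z [NY [NZ ->]]]] ->]]]].
by exists (A * Y)%M, Z; rewrite mmulA; split=> //; exists A, Y.
Qed.

Lemma disc_St_one N A : N A -> disc_St N 1 A.
Proof. by move=> NA; exists A, 1%M; rewrite mmulm1. Qed.

Lemma disc_St_nonempty N t : nonempty N -> nonempty (disc_St N t).
Proof.
move=> [A NA]; elim: t => [|t [X NX]]; first by exists 1%M.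
by exists (A * X)%M, A, X.
Qed.

Lemma disc_St_in_pi (K : vec n -> Prop) N t X :
  subset_pi K N -> disc_St N t X -> in_pi K X.
Proof.
move=> N_pos; elim: t X => [|t IH] X /=; first by move=> ->; exact: in_pi1.
by move=> [A [P [NA [/IH P_pos ->]]]]; apply: in_pi_mul => //; exact: N_pos.
Qed.

Lemma opnorm_disc_St N b t X : 0 <= b -> opnorm_bounded b N -> disc_St N t X ->
  opnorm X <= b ^ t.
Proof.
move=> b_ge0 N_le; elim: t X => [|t IH] X /=; first by move=> ->; exact: opnorm1_le1.
move=> [A [P [/N_le A_le [/IH P_le ->]]]]; apply: Rle_trans (opnorm_mul _ _) _.
exact: Rmult_le_compat.
Qed.

Definition rate_bound N r := exists C, 0 <= C /\
  forall t X, disc_St N t X -> opnorm X <= C * r ^ t.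

Definition growth_rate N rho := 0 <= rho /\
  (forall r, rho < r -> rate_bound N r) /\
  (forall r, 0 < r -> rate_bound N r -> rho <= r).

Lemma rate_bound_mono N r r' : 0 <= r <= r' -> rate_bound N r -> rate_bound N r'.
Proof.
move=> r_le [C [C_ge0 bound]]; exists C; split=> // t X /bound X_le.
by apply: Rle_trans X_le _; apply: Rmult_le_compat_l => //; exact: pow_incr.
Qed.

Lemma rate_bound_opnorm N b : 0 <= b -> opnorm_bounded b N -> rate_bound N b.
Proof.
move=> b_ge0 N_le; exists 1; split=> [|t X NX]; first lra.
by rewrite Rmult_1_l; exact: opnorm_disc_St NX.
Qed.

Lemma growth_rate_exists N b : 0 <= b -> opnorm_bounded b N -> exists rho, growth_rate N rho.
Proof.
move=> b_ge0 /(rate_bound_opnorm b_ge0) bound_b.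
pose E x := 0 < - x /\ rate_bound N (- x).
have E_bounded : bound E by exists 0 => x [x_lt0 _]; lra.
have [|l [l_ub l_least]] := completeness E E_bounded.
  exists (- (b + 1)); split; rewrite Ropp_involutive; first lra.
  by apply: rate_bound_mono bound_b; lra.
exists (- l); split; [|split].
- by suff : l <= 0 by [lra]; apply: l_least => x [x_lt0 _]; lra.
- move=> r lr; apply: NNPP => not_r; suff : l <= - r by lra.
  apply: l_least => x [x_lt0 bound_x]; apply: Rnot_lt_le => xr; apply: not_r.
  by apply: rate_bound_mono bound_x; lra.
move=> r r_gt0 bound_r; suff : - r <= l by lra.
by apply: l_ub; split; rewrite Ropp_involutive.
Qed.

Lemma growth_rate_le_opnorm N rho b : 0 <= b -> opnorm_bounded b N ->
  growth_rate N rho -> rho <= b.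
Proof.
move=> b_ge0 /(rate_bound_opnorm b_ge0) bound_b [_ [_ least]].
apply: le_epsilon => eps eps_gt0; apply: least; first lra.
by apply: rate_bound_mono bound_b; lra.
Qed.

Lemma growth_rate_ge N rho q : growth_rate N rho -> 0 < q ->
  (forall t, exists X, disc_St N t X /\ q ^ t <= opnorm X) -> q <= rho.
Proof.
move=> [rho_ge0 [bound _]] q_gt0 X_ge; apply: Rnot_lt_le => rho_q.
pose r := (rho + q) / 2; have [r_gt0 rq] : 0 < r /\ r < q by rewrite /r; lra.
have [|C [C_ge0 X_le]] := bound r; first by rewrite /r; lra.
have ratio_lt1 : Rabs (r / q) < 1.
  rewrite Rabs_pos_eq; first by apply/Rlt_div_l; lra.
  by apply: Rdiv_le_0_compat; lra.
have inv_gt0 : 0 < / (C + 1) by apply: Rinv_0_lt_compat; lra.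
have [t small] := pow_lt_1_zero _ ratio_lt1 _ inv_gt0.
have ratio_lt := Rle_lt_trans _ _ _ (Rle_abs _) (small t (Nat.le_refl t)).
have [X [NX qt_le]] := X_ge t; have rt_ge := Rle_trans _ _ _ qt_le (X_le t X NX).
have qt_gt0 := pow_lt q t q_gt0.
rewrite Rpow_mult_distr pow_inv in ratio_lt.
have rt_lt : (C + 1) * r ^ t < q ^ t.
  apply: (Rmult_lt_reg_r (/ (C + 1) * / q ^ t)).
    by apply: Rmult_lt_0_compat => //; exact: Rinv_0_lt_compat.
  rewrite (_ : _ * r ^ t * _ = r ^ t * / q ^ t); last by field; lra.
  by rewrite (_ : q ^ t * _ = / (C + 1)) //; field; lra.
by have := pow_lt r t r_gt0; lra.
Qed.

(* By submultiplicativity, a bound at the single time [t] propagates to all times. *)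
Lemma rate_bound_of_time N b t q : 0 <= b -> opnorm_bounded b N -> (0 < t)%N -> 0 < q ->
  (forall X, disc_St N t X -> opnorm X <= q ^ t) -> rate_bound N q.
Proof.
move=> b_ge0 N_le t_gt0 q_gt0 X_le; have q_ge0 := Rlt_le _ _ q_gt0.
pose a := Rmax 1 (b / q); have a_ge1 : 1 <= a by exact: Rmax_l.
have b_aq : b <= a * q.
  rewrite (_ : b = b / q * q); last by field; lra.
  by apply: Rmult_le_compat_r; [lra|exact: Rmax_r].
exists (a ^ t); split; first by apply: pow_le; lra.
elim/ltn_ind=> s IH X; case: (ltnP s t) => [st|ts] NX.
  apply: Rle_trans (opnorm_disc_St b_ge0 N_le NX) _.
  apply: Rle_trans (pow_incr _ _ s (conj b_ge0 b_aq)) _.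
  rewrite Rpow_mult_distr; apply: Rmult_le_compat_r; first exact: pow_le.
  by apply: Rle_pow => //; lia.
move: NX; rewrite -{1}(subnKC ts) => /disc_St_split[Y [Z [NY [NZ ->]]]].
rewrite -(subnKC ts) pow_add -Rmult_assoc (Rmult_comm (a ^ t)) Rmult_assoc.
apply: Rle_trans (opnorm_mul _ _) _; apply: Rmult_le_compat => //; first exact: X_le.
by apply: IH => //; lia.
Qed.

Lemma growth_rate_witness N rho b t q : 0 <= b -> opnorm_bounded b N ->
  growth_rate N rho -> (0 < t)%N -> 0 < q < rho ->
  exists X, disc_St N t X /\ q ^ t <= opnorm X.
Proof.
move=> b_ge0 N_le [_ [_ least]] t_gt0 [q_gt0 q_rho]; apply: NNPP => no_X.
suff : rho <= q by lra.
apply: least => //; apply: rate_bound_of_time N_le t_gt0 q_gt0 _ => // X NX.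
by apply: Rlt_le; apply: Rnot_le_lt => X_ge; apply: no_X; exists X.
Qed.

(* Expand a product of perturbed factors: each replaced factor costs [G * h]. *)
Lemma growth_perturbation N1 N2 G r h : 0 <= G -> 0 <= r -> 0 <= h ->
  (forall t X, disc_St N2 t X -> opnorm X <= G * r ^ t) -> within h N1 N2 ->
  forall t X, disc_St N1 t X -> opnorm X <= G * (r + G * h) ^ t.
Proof.
move=> G_ge0 r_ge0 h_ge0 N2_le N12.
have Gh_ge0 := Rmult_le_pos _ _ G_ge0 h_ge0.
set r' := r + G * h; have r'_ge0 : 0 <= r' by rewrite /r'; lra.
suff mixed t X : disc_St N1 t X -> forall s Y, disc_St N2 s Y ->
    opnorm (Y * X) <= G * r ^ s * r' ^ t.
  by move=> t X /mixed /(_ 0%N 1%M erefl); rewrite mmul1m /= Rmult_1_r.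
elim: t X => [|t IH] X /=.
  by move=> -> s Y /N2_le; rewrite mmulm1 Rmult_1_r.
move=> [A [P [/N12[B [NB AB]] [/IH YP_le ->]]]] s Y NY.
rewrite (_ : Y * (A * P) = Y * B * P + Y * ((A - B) * P))%M; last first.
  by rewrite mmulBl mmulBr -!mmulA; mring.
apply: Rle_trans (opnorm_triangle _ _) _.
have YBP_le := YP_le (s + 1)%N _ (disc_St_mul NY (disc_St_one NB)).
have P_le := YP_le 0%N _ (erefl : disc_St N2 0 1%M).
rewrite mmul1m /= Rmult_1_r in P_le; rewrite pow_add /= Rmult_1_r in YBP_le.
have YABP_le : opnorm (Y * ((A - B) * P)) <= G * r ^ s * (h * (G * r' ^ t)).
  apply: Rle_trans (opnorm_mul _ _) _; apply: Rmult_le_compat => //; first exact: N2_le.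
  by apply: Rle_trans (opnorm_mul _ _) _; exact: Rmult_le_compat.
apply: Rle_trans (Rplus_le_compat _ _ _ _ YBP_le YABP_le) _.
by apply: Req_le; rewrite /r'; ring.
Qed.

End DiscreteSemigroup.

(** * Uniform growth of positive semigroups *)

Lemma lub_le_of_mul_le (E : R -> Prop) beta a d : is_lub E beta -> 0 < a -> 0 <= d ->
  (forall u v, E u -> E v -> a * u * v <= d * beta) -> beta <= d / a.
Proof.
move=> [_ beta_least] a_gt0 d_ge0 mul_le; apply: Rnot_lt_le => lt_beta.
have da_ge0 : 0 <= d / a by apply: Rdiv_le_0_compat.
have [u [Eu u_gt]] : exists u, E u /\ d / a < u.
  apply: NNPP => no_u; suff : beta <= d / a by lra.
  by apply: beta_least => u Eu; apply: Rnot_lt_le => u_gt; apply: no_u; exists u.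
have au_gt : d < a * u.
  by have := Rmult_lt_compat_l _ _ _ a_gt0 u_gt; rewrite (_ : a * (d / a) = d) //; field; lra.
have [au_gt0 beta_gt0] : 0 < a * u /\ 0 < beta by lra.
suff : beta <= d * beta / (a * u).
  move=> /(Rmult_le_compat_r _ _ _ (Rlt_le _ _ au_gt0)).
  rewrite (_ : d * beta / (a * u) * (a * u) = d * beta); last by field; lra.
  by have := Rmult_lt_compat_r _ _ _ beta_gt0 au_gt; lra.
apply: beta_least => v Ev; apply: (Rmult_le_reg_l (a * u)) => //.
by rewrite (_ : a * u * (d * beta / (a * u)) = d * beta); [exact: mul_le|field; lra].
Qed.

Section UniformGrowth.
Variables (n : nat) (K : vec n -> Prop) (e : vec n) (kappa : R).
Hypotheses (K_proper : proper_cone K) (e_unit : order_unit K e).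
Hypothesis kappa_normal : normality_constant K kappa.
Implicit Types (N : mat n -> Prop) (A B X : mat n).

Definition orbit_ratio N r v :=
  exists t X, disc_St N t X /\ v = vnorm (X *v e) / r ^ t.

Lemma orbit_ratio_lub N r : 0 < r -> rate_bound N r -> exists beta, is_lub (orbit_ratio N r) beta.
Proof.
move=> r_gt0 [C [C_ge0 bound]].
have [||beta lub] := @completeness (orbit_ratio N r); last by exists beta.
  exists (C * vnorm e) => v [t [X [NX ->]]]; have rt_gt0 := pow_lt r t r_gt0.
  apply: (Rmult_le_reg_r (r ^ t)) => //.
  rewrite (_ : _ / r ^ t * r ^ t = vnorm (X *v e)); last by field; lra.
  apply: Rle_trans (vnorm_mapply _ _) _.
  by have := Rmult_le_compat_r _ _ _ (vnorm_ge0 e) (bound t X NX); lra.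
by exists (vnorm (1 *v e) / r ^ 0), 0%N, 1%M.
Qed.

Lemma vnorm_orbit_le N r beta t X : 0 < r -> is_lub (orbit_ratio N r) beta ->
  disc_St N t X -> vnorm (X *v e) <= beta * r ^ t.
Proof.
move=> r_gt0 [beta_ub _] NX; have rt_gt0 := pow_lt r t r_gt0.
have /(Rmult_le_compat_r _ _ _ (Rlt_le _ _ rt_gt0)) : vnorm (X *v e) / r ^ t <= beta.
  by apply: beta_ub; exists t, X.
by rewrite (_ : _ / r ^ t * r ^ t = vnorm (X *v e)) //; field; lra.
Qed.

Lemma vnorm_neumann_orbit_le N B beta r m s t S T : mconv N B ->
  (forall t X, disc_St N t X -> vnorm (X *v e) <= beta * r ^ t) ->
  disc_St N s S -> disc_St N t T ->
  vnorm (S *v (neumann_sum B m *v (T *v e))) <= beta * sum_f_R0 (pow r) m * r ^ (s + t).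
Proof.
move=> NB orbit_le NS NT.
have ST_le s' S' : disc_St N s' S' -> vnorm (S' *v (T *v e)) <= beta * r ^ (s' + t).
  by move=> NS'; rewrite -mapplyM; apply: orbit_le; exact: disc_St_mul.
elim: m s S NS => [|m IH] s S NS.
  by rewrite /= mapply1 Rmult_1_r; exact: ST_le.
rewrite mapply_neumann_sumS mapplyDr geometric_sumS.
apply: Rle_trans (vnorm_triangle _ _) _.
set w := (neumann_sum B m *v _)%V in IH *.
have SBw_le : vnorm (S *v (B *v w)) <= beta * sum_f_R0 (pow r) m * r ^ (s + 1 + t).
  apply: (mconv_sublinear_le (f := fun X => vnorm (S *v (X *v w))) _ _ _ NB)
    => [|X Y|a X a_ge0|A NA].
  - by rewrite mapply0 mapplyv0 vnorm0.
  - by rewrite mapplyDl mapplyDr; exact: vnorm_triangle.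
  - by rewrite mapplyZl mapplyZr vnormZ_ge0 //; lra.
  by rewrite -mapplyM; apply: IH; apply: disc_St_mul => //; exact: disc_St_one.
apply: Rle_trans (Rplus_le_compat _ _ _ _ (ST_le s S NS) SBw_le) _.
by rewrite addn1 addSn /=; apply: Req_le; ring.
Qed.

Lemma orbit_ratio_mul_le N B m a r beta : subset_pi K N -> mconv N B ->
  0 < a -> uniformly_positive K e a (neumann_sum B m) -> 0 < r ->
  is_lub (orbit_ratio N r) beta ->
  forall u v, orbit_ratio N r u -> orbit_ratio N r v ->
  a * u * v <= kappa * sum_f_R0 (pow r) m * beta.
Proof.
move=> N_pos NB a_gt0 B_pos r_gt0 lub u v [s [S [NS ->]]] [t [T [NT ->]]].
have [kappa_gt0 normal] := kappa_normal; have Ke := order_unit_cone e_unit.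
have [S_pos T_pos] := (disc_St_in_pi N_pos NS, disc_St_in_pi N_pos NT).
have [rs_gt0 rt_gt0] := (pow_lt r s r_gt0, pow_lt r t r_gt0).
have aT_ge0 : 0 <= a * vnorm (T *v e) by apply: Rmult_le_pos => //; lra.
have /(normal _ _ (coneZ K_proper aT_ge0 (S_pos _ Ke))) :
    S *v (neumann_sum B m *v (T *v e)) >=[K] (a * vnorm (T *v e)) *: (S *v e).
  by rewrite -mapplyZr; apply: Kge_mapply => //; apply: B_pos; exact: T_pos.
rewrite vnormZ_ge0 // => lower.
have upper := vnorm_neumann_orbit_le m NB (fun t X => vnorm_orbit_le r_gt0 lub) NS NT.
apply: (Rmult_le_reg_r (r ^ (s + t))); first by rewrite pow_add; exact: Rmult_lt_0_compat.
have := Rmult_le_compat_l _ _ _ (Rlt_le _ _ kappa_gt0) upper.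
rewrite (_ : _ * _ * _ * r ^ _ = a * vnorm (T *v e) * vnorm (S *v e)); first lra.
by rewrite pow_add; field; lra.
Qed.

Definition growth_constant a r m := (2 * kappa + 1) * (kappa * sum_f_R0 (pow r) m / a).

Lemma growth_constant_mono a r r' m : 0 < a -> 0 <= r <= r' ->
  0 <= growth_constant a r m <= growth_constant a r' m.
Proof.
move=> a_gt0 [r_ge0 r_le]; have [kappa_gt0 _] := kappa_normal.
have sum_ge1 := geometric_sum_ge1 m r_ge0.
have sum_le : sum_f_R0 (pow r) m <= sum_f_R0 (pow r') m.
  by apply: sum_Rle => k _; exact: pow_incr.
have inv_gt0 := Rinv_0_lt_compat _ a_gt0.
split; first by apply: Rmult_le_pos; [lra|apply: Rdiv_le_0_compat => //; apply: Rmult_le_pos; lra].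
apply: Rmult_le_compat_l; first lra; apply: Rmult_le_compat_r; first lra.
by apply: Rmult_le_compat_l; lra.
Qed.

(* The constant does not depend on the one hidden in [rate_bound N r]: by positivity,
   [orbit_ratio N r] is supermultiplicative up to a factor, so its supremum [beta]
   satisfies [a * beta ^ 2 <= kappa * (1 + r + ... + r ^ m) * beta]. *)
Lemma uniform_growth N B m a r : subset_pi K N -> mconv N B ->
  0 < a -> uniformly_positive K e a (neumann_sum B m) -> 0 < r -> rate_bound N r ->
  forall t X, disc_St N t X -> opnorm X <= growth_constant a r m * r ^ t.
Proof.
move=> N_pos NB a_gt0 B_pos r_gt0 bound t X NX.
have [beta lub] := orbit_ratio_lub r_gt0 bound; have [kappa_gt0 _] := kappa_normal.
have beta_le : beta <= kappa * sum_f_R0 (pow r) m / a.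
  apply: (lub_le_of_mul_le lub a_gt0); last first.
    exact: orbit_ratio_mul_le N_pos NB a_gt0 B_pos r_gt0 lub.
  by have := geometric_sum_ge1 m (Rlt_le _ _ r_gt0); nra.
apply: Rle_trans (opnorm_order_unit (disc_St_in_pi N_pos NX) e_unit kappa_normal) _.
rewrite Rmult_assoc; apply: Rmult_le_compat_l; first lra.
apply: Rle_trans (vnorm_orbit_le r_gt0 lub NX) _; apply: Rmult_le_compat_r => //.
by apply: Rlt_le; exact: pow_lt.
Qed.

Lemma uniformly_positive_nearby B m a : 0 < a ->
  uniformly_positive K e a (neumann_sum B m) -> exists delta, 0 < delta /\
  forall B', opnorm (B - B') <= delta -> uniformly_positive K e (a / 2) (neumann_sum B' m).
Proof.
move=> a_gt0 B_pos; have B_ge0 := opnorm_ge0 B.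
have [|L [L_ge0 lipschitz]] := @neumann_sum_lipschitz n (opnorm B + 1) m; first lra.
have quot_gt0 : 0 < a / 2 / (L + 1) by apply: Rdiv_lt_0_compat; lra.
exists (Rmin 1 (a / 2 / (L + 1))); split; first by apply: Rmin_pos; lra.
move=> B' BB'; have [min1 min_quot] := (Rmin_l 1 (a / 2 / (L + 1)), Rmin_r 1 (a / 2 / (L + 1))).
rewrite (_ : a / 2 = a - a / 2); last by field.
apply: (uniformly_positive_perturb K_proper e_unit B_pos).
apply: Rle_trans (lipschitz B B' _ _) _; first lra.
  by have := opnorm_le_sub B' B; rewrite opnorm_subC; lra.
rewrite [X in _ <= X](_ : _ = (L + 1) * (a / 2 / (L + 1))); last by field; lra.
by apply: Rmult_le_compat => //; lra.
Qed.

End UniformGrowth.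

Lemma uniform_growth_nearby n (K : vec n -> Prop) (M : mat n -> Prop) B r0 :
  proper_cone K -> mconv M B -> K_irreducible K B -> 0 <= r0 ->
  exists delta G, 0 < delta /\ 0 <= G /\ forall N r,
    subset_pi K N -> within delta M N -> 0 < r <= r0 -> rate_bound N r ->
    forall t X, disc_St N t X -> opnorm X <= G * r ^ t.
Proof.
move=> K_proper MB irr r0_ge0.
have [e e_unit] := order_unit_exists K_proper.
have [kappa normal] := normality_constant_exists K_proper.
have [m [a [a_gt0 B_pos]]] := irreducible_uniformly_positive K_proper irr e_unit.
have [delta [delta_gt0 near_B]] := uniformly_positive_nearby K_proper e_unit a_gt0 B_pos.
have a2_gt0 : 0 < a / 2 by lra.
have G_mono r := growth_constant_mono normal (r := r) (r' := r0) m a2_gt0.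
exists delta, (growth_constant kappa (a / 2) r0 m); split=> //.
split=> [|N r N_pos MN [r_gt0 r_le] bound t X NX].
  by apply: (proj1 (G_mono r0 _)); lra.
have [B' [NB' BB']] := mconv_within MN MB.
apply: Rle_trans (uniform_growth K_proper e_unit normal N_pos NB' a2_gt0
  (near_B B' BB') r_gt0 bound NX) _.
apply: Rmult_le_compat_r; first by apply: Rlt_le; exact: pow_lt.
by apply: (proj2 (G_mono r _)); lra.
Qed.

Lemma growth_rate_lipschitz n (K : vec n -> Prop) (M : mat n -> Prop) B b :
  proper_cone K -> mconv M B -> K_irreducible K B -> 0 <= b ->
  exists delta L, 0 < delta /\ 0 <= L /\ forall N1 N2 h rho1 rho2,
    subset_pi K N2 -> opnorm_bounded b N2 -> within delta M N2 ->
    0 <= h -> within h N1 N2 -> growth_rate N1 rho1 -> growth_rate N2 rho2 ->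
    rho1 <= rho2 + L * h.
Proof.
move=> K_proper MB irr b_ge0.
have [|delta [G [delta_gt0 [G_ge0 growth]]]] :=
  @uniform_growth_nearby n K M B (b + 1) K_proper MB irr; first lra.
exists delta, G; do 2 split=> //.
move=> N1 N2 h rho1 rho2 N2_pos N2_le MN2 h_ge0 N12 rate1 rate2.
have rho2_le := growth_rate_le_opnorm b_ge0 N2_le rate2; have rho2_ge0 := rate2.1.
have Gh_ge0 := Rmult_le_pos _ _ G_ge0 h_ge0.
apply: le_epsilon => eps eps_gt0.
have [min1 min_eps] := (Rmin_l 1 eps, Rmin_r 1 eps).
have min_gt0 : 0 < Rmin 1 eps by apply: Rmin_pos; lra.
set r := rho2 + Rmin 1 eps; have r_le : 0 < r <= b + 1 by rewrite /r; lra.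
have bound_r : rate_bound N2 r by apply: rate2.2.1; rewrite /r; lra.
apply: Rle_trans (_ : r + G * h <= _); last by rewrite /r; lra.
apply: rate1.2.2; first lra.
exists G; split=> //; apply: growth_perturbation N12 => //; first lra.
exact: growth.
Qed.

(** * The Hausdorff distance *)

Lemma Rsup_is_lub (E : R -> Prop) b :
  nonempty E -> (forall x, E x -> x <= b) -> is_lub E (Rsup E).
Proof.
move=> E_nonempty E_le; apply: epsilon_spec.
have E_bounded : bound E by exists b.
by have [l lub] := completeness E E_bounded E_nonempty; exists l.
Qed.

Lemma Rinf_is_glb (E : R -> Prop) a : nonempty E -> (forall x, E x -> a <= x) ->
  (forall x, E x -> Rinf E <= x) /\ (forall l, (forall x, E x -> l <= x) -> l <= Rinf E).
Proof.
move=> [x0 Ex0] E_ge; rewrite /Rinf.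
have [|x Ex|opp_ub opp_least] := @Rsup_is_lub (fun x => E (- x)) (- a).
- by exists (- x0); rewrite Ropp_involutive.
- by have := E_ge _ Ex; lra.
split=> [x Ex|l l_le]; first by have := opp_ub (- x); rewrite Ropp_involutive => /(_ Ex); lra.
by suff : Rsup (fun x => E (- x)) <= - l; [lra|apply: opp_least => x /l_le; lra].
Qed.

Lemma Rinf_lt_witness (E : R -> Prop) a h : nonempty E -> (forall x, E x -> a <= x) ->
  Rinf E < h -> exists x, E x /\ x < h.
Proof.
move=> E_nonempty E_ge inf_lt; apply: NNPP => no_x.
have [_ inf_greatest] := Rinf_is_glb E_nonempty E_ge.
suff : h <= Rinf E by lra.
by apply: inf_greatest => x Ex; apply: Rnot_lt_le => x_lt; apply: no_x; exists x.
Qed.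

Definition directed_dist T (d : T -> T -> R) (M N : T -> Prop) :=
  Rsup (fun r => exists A, M A /\ r = Rinf (fun s => exists B, N B /\ s = d A B)).

Lemma directed_dist_lt T (d : T -> T -> R) (M N : T -> Prop) b h A :
  (forall A B, 0 <= d A B) -> (forall A B, M A -> N B -> d A B <= b) -> nonempty N ->
  directed_dist d M N < h -> M A -> exists B, N B /\ d A B < h.
Proof.
move=> d_ge0 d_le [B0 NB0] dist_lt MA; pose dists A' s := exists B, N B /\ s = d A' B.
have dists_nonempty A' : nonempty (dists A') by exists (d A' B0), B0.
have dists_ge0 A' s : dists A' s -> 0 <= s by move=> [B [_ ->]].
have [||sup_ub _] := @Rsup_is_lub (fun r => exists A', M A' /\ r = Rinf (dists A')) b.
- by exists (Rinf (dists A)), A.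
- move=> r [A' [MA' ->]]; apply: Rle_trans (d_le A' B0 MA' NB0).
  by apply: (Rinf_is_glb (dists_nonempty A') (@dists_ge0 A')).1; exists B0.
have [|s [[B [NB ->]] s_lt]] := @Rinf_lt_witness (dists A) 0 h (dists_nonempty A) (@dists_ge0 A).
  by apply: Rle_lt_trans dist_lt; apply: sup_ub; exists A.
by exists B.
Qed.

Section Hausdorff.
Variable n : nat.
Implicit Types M N : mat n -> Prop.

Definition mutually_within h M N := within h M N /\ within h N M.

Lemma mutually_withinC h M N : mutually_within h M N -> mutually_within h N M.
Proof. by case. Qed.

Lemma mutually_within_le h h' M N : h <= h' -> mutually_within h M N -> mutually_within h' M N.
Proof.
move=> h_le [MN NM]; split=> A; first by move=> /MN[B [NB AB]]; exists B; split=> //; lra.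
by move=> /NM[B [MB AB]]; exists B; split=> //; lra.
Qed.

Lemma hausdorffC M N : hausdorff M N = hausdorff N M.
Proof.
have mdist_swap : @mdist n = fun A B => mdist B A.
  by do 2 apply: functional_extensionality => ?; exact: mdistC.
by rewrite /hausdorff Rmax_comm {1 4}mdist_swap.
Qed.

Lemma hausdorff_lt_mdist M N b c h A : opnorm_bounded b M -> opnorm_bounded c N ->
  nonempty N -> hausdorff M N < h -> M A -> exists B, N B /\ mdist A B < h.
Proof.
move=> M_le N_le N_nonempty dist_lt MA.
apply: (@directed_dist_lt _ (@mdist n) M N (b + c)) => // [X Y|X Y /M_le X_le /N_le Y_le|].
- exact: mnorm_ge0.
- apply: Rle_trans (mnorm_le_opnorm _) _.
  by apply: Rle_trans (opnorm_triangle _ _) _; rewrite opnormN; lra.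
exact: Rle_lt_trans (Rmax_l _ _) dist_lt.
Qed.

Lemma hausdorff_ge0 M N b c : opnorm_bounded b M -> opnorm_bounded c N ->
  nonempty M -> nonempty N -> 0 <= hausdorff M N.
Proof.
move=> M_le N_le [A MA] N_nonempty; apply: Rnot_lt_le => dist_lt.
have [B [NB AB]] := hausdorff_lt_mdist M_le N_le N_nonempty dist_lt MA.
by have := mnorm_ge0 (A - B); rewrite -/(mdist A B); lra.
Qed.

Lemma hausdorff_lt_within M N b c h : opnorm_bounded b M -> opnorm_bounded c N ->
  nonempty M -> nonempty N -> hausdorff M N < h -> mutually_within (INR n * h) M N.
Proof.
have one_way (M' N' : mat n -> Prop) b' c' : opnorm_bounded b' M' -> opnorm_bounded c' N' ->
    nonempty N' -> hausdorff M' N' < h -> within (INR n * h) M' N'.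
  move=> M_le N_le N_nonempty dist_lt A MA.
  have [B [NB AB]] := hausdorff_lt_mdist M_le N_le N_nonempty dist_lt MA.
  exists B; split=> //; apply: Rle_trans (opnorm_le_mnorm _) _.
  by apply: Rmult_le_compat_l => //; exact: Rlt_le.
move=> M_le N_le M_nonempty N_nonempty dist_lt; split.
  exact: one_way M_le N_le N_nonempty dist_lt.
by rewrite hausdorffC in dist_lt; exact: one_way N_le M_le M_nonempty dist_lt.
Qed.

Lemma loc_lipschitz_of_within (P : (mat n -> Prop) -> Prop) (f : (mat n -> Prop) -> R) :
  (forall M, P M -> nonempty M /\ exists b, opnorm_bounded b M) ->
  (forall M, P M -> exists delta L, 0 < delta /\ 0 <= L /\ forall N1 N2 h, P N1 -> P N2 ->
    mutually_within delta M N1 -> mutually_within delta M N2 ->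
    0 <= h -> mutually_within h N1 N2 -> f N1 <= f N2 + L * h) ->
  loc_lipschitz P f.
Proof.
move=> P_bounded one_sided M PM; have [delta [L [delta_gt0 [L_ge0 f_le]]]] := one_sided M PM.
have [M_nonempty [b M_le]] := P_bounded M PM.
have n1_gt0 : 0 < INR n + 1 by have := pos_INR n; lra.
exists (delta / (INR n + 1)), (L * INR n).
split; first exact: Rdiv_lt_0_compat; split; first exact: Rmult_le_pos.
have near_M N : P N -> hausdorff M N < delta / (INR n + 1) -> mutually_within delta M N.
  move=> /P_bounded[N_nonempty [c N_le]] MN.
  apply: mutually_within_le (hausdorff_lt_within M_le N_le M_nonempty N_nonempty MN).
  rewrite [X in _ <= X](_ : _ = (INR n + 1) * (delta / (INR n + 1))); last by field; lra.
  apply: Rmult_le_compat_r; last lra.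
  by apply: Rlt_le; exact: Rdiv_lt_0_compat.
move=> N1 N2 PN1 PN2 /(near_M _ PN1) MN1 /(near_M _ PN2) MN2.
have [N1_nonempty [b1 N1_le]] := P_bounded N1 PN1.
have [N2_nonempty [b2 N2_le]] := P_bounded N2 PN2.
have H_ge0 := hausdorff_ge0 N1_le N2_le N1_nonempty N2_nonempty.
set H := hausdorff N1 N2 in H_ge0 *.
have Ln1_gt0 : 0 < L * INR n + 1 by have := Rmult_le_pos _ _ L_ge0 (pos_INR n); lra.
apply: le_epsilon => eps eps_gt0; set h := H + eps / (L * INR n + 1).
have quot_gt0 : 0 < eps / (L * INR n + 1) by exact: Rdiv_lt_0_compat.
have N12 : mutually_within (INR n * h) N1 N2.
  by apply: hausdorff_lt_within N1_le N2_le N1_nonempty N2_nonempty _; rewrite -/H /h; lra.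
have nh_ge0 : 0 <= INR n * h by apply: Rmult_le_pos => //; rewrite /h; lra.
have f12 := f_le N1 N2 _ PN1 PN2 MN1 MN2 nh_ge0 N12.
have f21 := f_le N2 N1 _ PN2 PN1 MN2 MN1 nh_ge0 (mutually_withinC N12).
have : L * INR n * h <= L * INR n * H + eps.
  rewrite /h Rmult_plus_distr_l; apply: Rplus_le_compat_l.
  rewrite [X in _ <= X](_ : _ = (L * INR n + 1) * (eps / (L * INR n + 1))); last by field; lra.
  by apply: Rmult_le_compat_r; lra.
by move=> Lnh_le; apply: Rabs_le; lra.
Qed.

End Hausdorff.

(** * The discrete joint spectral radius *)

Lemma exp_le x y : x <= y -> exp x <= exp y.
Proof. by case=> [xy|->]; [apply: Rlt_le; exact: exp_increasing|lra]. Qed.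

Lemma Rpower_dominates C q q' : 0 < q < q' ->
  exists T, 0 < T /\ forall t, T <= t -> C * Rpower q t <= Rpower q' t.
Proof.
move=> [q_gt0 qq']; set d := ln q' - ln q.
have d_gt0 : 0 < d by have := ln_increasing _ _ q_gt0 qq'; rewrite /d; lra.
exists (Rmax 1 (C / d)); split; first by have := Rmax_l 1 (C / d); lra.
move=> t t_ge; have t_ge' := Rle_trans _ _ _ (Rmax_r 1 (C / d)) t_ge.
rewrite (_ : Rpower q' t = exp (t * d) * Rpower q t); last first.
  by rewrite /Rpower -exp_plus /d; congr exp; ring.
apply: Rmult_le_compat_r; first exact: exp_ge0.
apply: Rle_trans (exp_ineq1_le _).
have := Rmult_le_compat_r _ _ _ (Rlt_le _ _ d_gt0) t_ge'.
by rewrite (_ : C / d * d = C); [lra|field; lra].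
Qed.

Lemma root_t_le x t u : 0 < t -> 0 < u -> x <= Rpower u t -> root_t x t <= u.
Proof.
move=> t_gt0 u_gt0 x_le; rewrite /root_t; case: Rlt_dec => /= x_gt0; last lra.
have -> : u = Rpower (Rpower u t) (/ t) by rewrite Rpower_mult Rinv_r ?Rpower_1; lra.
by apply: Rle_Rpower_l => //; exact: Rinv_ge0.
Qed.

Lemma le_root_t x t u : 0 < t -> 0 < u -> Rpower u t <= x -> u <= root_t x t.
Proof.
move=> t_gt0 u_gt0 x_ge; have u_pow_gt0 : 0 < Rpower u t := exp_pos _.
rewrite /root_t; case: Rlt_dec => /= x_gt0; last lra.
have {1}-> : u = Rpower (Rpower u t) (/ t) by rewrite Rpower_mult Rinv_r ?Rpower_1; lra.
by apply: Rle_Rpower_l => //; exact: Rinv_ge0.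
Qed.

Definition exponential_growth (G : R -> R -> Prop) rho := 0 <= rho /\
  (forall q, rho < q -> exists C, forall t x, G t x -> x <= C * Rpower q t) /\
  (forall q, 0 < q < rho -> exists C, 0 < C /\ forall t x, G t x -> Rpower q t <= C * x).

Lemma root_t_cvg G rho : exponential_growth G rho -> forall eps, 0 < eps ->
  exists T, forall t x, T <= t -> G t x -> Rabs (root_t x t - rho) < eps.
Proof.
move=> [rho_ge0 [upper lower]] eps eps_gt0.
have [T1 [T1_gt0 root_lt]] : exists T, 0 < T /\ forall t x, T <= t -> G t x ->
    root_t x t < rho + eps.
  have [|C x_le] := upper (rho + eps / 4); first lra.
  have [|T [T_gt0 dominates]] := @Rpower_dominates C (rho + eps / 4) (rho + eps / 2); first lra.
  exists T; split=> // t x Tt Gtx; apply: Rle_lt_trans (_ : rho + eps / 2 < _); last lra.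
  by apply: root_t_le; [lra|lra|exact: Rle_trans (x_le _ _ Gtx) (dominates _ Tt)].
have [T2 [T2_gt0 root_gt]] : exists T, 0 < T /\ forall t x, T <= t -> G t x ->
    rho - eps < root_t x t.
  case: (Rlt_le_dec rho eps) => rho_eps.
    exists 1; split=> [|t x _ _]; first lra; apply: Rlt_le_trans (_ : 0 <= _); first lra.
    by rewrite /root_t; case: Rlt_dec => /= *; [exact: exp_ge0|lra].
  have [|C [C_gt0 x_ge]] := lower (rho - eps / 4); first lra.
  have [|T [T_gt0 dominates]] := @Rpower_dominates C (rho - eps / 2) (rho - eps / 4); first lra.
  exists T; split=> // t x Tt Gtx; apply: Rlt_le_trans (_ : rho - eps / 2 <= _); first lra.
  apply: le_root_t; [lra|lra|apply: (Rmult_le_reg_l C) => //].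
  exact: Rle_trans (dominates _ Tt) (x_ge _ _ Gtx).
exists (Rmax T1 T2) => t x Tt Gtx.
have := root_lt t x (Rle_trans _ _ _ (Rmax_l _ _) Tt) Gtx.
have := root_gt t x (Rle_trans _ _ _ (Rmax_r _ _) Tt) Gtx.
by move=> *; apply: Rabs_def1; lra.
Qed.

Section SupNorm.
Variable n : nat.
Implicit Types (S : mat n -> Prop) (X : mat n).

Lemma sup_norm_is_lub S b : nonempty S -> opnorm_bounded b S ->
  is_lub (fun r => exists X, S X /\ r = mnorm X) (sup_norm S).
Proof.
move=> [X SX] S_le; apply: (@Rsup_is_lub _ b) => [|r [Y [/S_le Y_le ->]]].
  by exists (mnorm X), X.
exact: Rle_trans (mnorm_le_opnorm Y) Y_le.
Qed.

Lemma sup_norm_le S b : nonempty S -> opnorm_bounded b S -> sup_norm S <= b.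
Proof.
move=> S_nonempty S_le; apply: (sup_norm_is_lub S_nonempty S_le).2 => r [X [/S_le X_le ->]].
exact: Rle_trans (mnorm_le_opnorm X) X_le.
Qed.

Lemma mnorm_le_sup_norm S b X : opnorm_bounded b S -> S X -> mnorm X <= sup_norm S.
Proof.
move=> S_le SX; have S_nonempty : nonempty S by exists X.
by apply: (sup_norm_is_lub S_nonempty S_le).1; exists X.
Qed.

Lemma opnorm_le_sup_norm S b X : opnorm_bounded b S -> S X ->
  opnorm X <= (INR n + 1) * sup_norm S.
Proof.
move=> S_le SX; have X_le := mnorm_le_sup_norm S_le SX.
have := Rmult_le_compat_l _ _ _ (pos_INR n) X_le.
by have := opnorm_le_mnorm X; have := mnorm_ge0 X; lra.
Qed.

Lemma mcompact_opnorm_bounded M : mcompact M -> exists b, 0 <= b /\ @opnorm_bounded n b M.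
Proof.
move=> [[b M_le] _]; exists (INR n * Rabs b).
split=> [|A /M_le A_le]; first by apply: Rmult_le_pos => //; exact: Rabs_pos.
apply: Rle_trans (opnorm_le_mnorm A) _; apply: Rmult_le_compat_l => //.
exact: Rle_trans A_le (Rle_abs b).
Qed.

End SupNorm.

Lemma jsr_disc_growth_rate n (N : mat n -> Prop) b : 0 <= b -> nonempty N ->
  opnorm_bounded b N -> growth_rate N (jsr_disc N).
Proof.
move=> b_ge0 N_nonempty N_le; have [rho rate] := growth_rate_exists b_ge0 N_le.
have St_le t : opnorm_bounded (b ^ t) (disc_St N t) by move=> X; exact: opnorm_disc_St.
pose G t x := exists k, (0 < k)%N /\ t = INR k /\ x = sup_norm (disc_St N k).
have growth : exponential_growth G rho.
  split; first exact: rate.1; split=> [q rho_q|q q_rho].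
    have [C [_ X_le]] := rate.2.1 q rho_q; exists C => t x [k [_ [-> ->]]].
    rewrite Rpower_pow; last by have := rate.1; lra.
    by apply: sup_norm_le; [exact: disc_St_nonempty|exact: X_le].
  exists (INR n + 1); split=> [|t x [k [k_gt0 [-> ->]]]]; first by have := pos_INR n; lra.
  have [X [NX X_ge]] := growth_rate_witness b_ge0 N_le rate k_gt0 q_rho.
  rewrite Rpower_pow; last lra.
  exact: Rle_trans X_ge (opnorm_le_sup_norm (St_le k) NX).
suff cvg : Un_cv (fun t => root_t (sup_norm (disc_St N t)) (INR t)) rho.
  suff -> : jsr_disc N = rho by [].
  exact: UL_sequence (epsilon_spec (inhabits 0) _ (ex_intro _ rho cvg)) cvg.
move=> eps eps_gt0; have [T root_near] := root_t_cvg growth eps_gt0.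
have [k k_gt] := INR_unbounded T; exists k.+1 => t t_ge; apply: root_near.
  by apply: Rle_trans (Rlt_le _ _ k_gt) _; apply: le_INR; lia.
by exists t; split=> //; lia.
Qed.

Lemma loc_lipschitz_jsr_disc n (K : vec n -> Prop) :
  proper_cone K -> loc_lipschitz (P_disc K) (@jsr_disc n).
Proof.
move=> K_proper; apply: loc_lipschitz_of_within => M [_ [M_compact [M_nonempty irr_conv]]].
  by have [b [_ M_le]] := mcompact_opnorm_bounded M_compact; split=> //; exists b.
have [b [b_ge0 M_le]] := mcompact_opnorm_bounded M_compact.
have [B [MB irr]] := irr_conv; have b1_ge0 : 0 <= b + 1 by lra.
have [delta [L [delta_gt0 [L_ge0 lipschitz]]]] := growth_rate_lipschitz K_proper MB irr b1_ge0.
have min_gt0 : 0 < Rmin delta 1 by apply: Rmin_pos; lra.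
exists (Rmin delta 1), L; do 2 split=> //.
have rate N : P_disc K N -> mutually_within (Rmin delta 1) M N ->
    opnorm_bounded (b + 1) N /\ growth_rate N (jsr_disc N).
  move=> [_ [_ [N_nonempty _]]] /(mutually_within_le (Rmin_r _ _))[_ NM].
  have N_le := opnorm_bounded_within M_le NM.
  by split=> //; exact: jsr_disc_growth_rate N_nonempty N_le.
move=> N1 N2 h PN1 PN2 /(rate _ PN1)[_ rate1] MN2 h_ge0 [N12 _].
have [N2_le rate2] := rate _ PN2 MN2; have [N2_pos _] := PN2.
have [MN2' _] := mutually_within_le (Rmin_l _ _) MN2.
exact: lipschitz rate1 rate2.
Qed.

(** * The matrix exponential *)

Lemma is_series_abs_le (a b : nat -> R) la lb : is_series a la -> is_series b lb ->
  (forall k, Rabs (a k) <= b k) -> Rabs la <= lb.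
Proof.
move=> a_la b_lb ab; rewrite -(is_series_unique _ _ a_la) -(is_series_unique _ _ b_lb).
have b_summable : ex_series b by exists lb.
have abs_summable : ex_series (fun k => Rabs (a k)).
  apply: (ex_series_le (V := R_CompleteNormedModule)) b_summable => k.
  by rewrite /norm /= /abs /= Rabs_Rabsolu.
apply: Rle_trans (Series_Rabs _ abs_summable) _; apply: Series_le => // k.
by split=> //; exact: Rabs_pos.
Qed.

Lemma is_series_exp x : is_series (fun k => x ^ k / INR (fact k)) (exp x).
Proof.
apply: is_series_ext (is_exp_Reals x) => k.
by rewrite /scal /= /mult /= pow_n_pow /Rdiv Rmult_comm.
Qed.

Arguments is_series_exp : clear implicits.

Lemma is_series_rsum n (a : 'I_n -> nat -> R) (v : 'I_n -> R) :
  (forall l, is_series (a l) (v l)) ->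
  is_series (fun k => \rsum_(l < n) a l k) (\rsum_(l < n) v l).
Proof.
move=> a_v; elim: (index_enum _) => [|l s IH].
  rewrite big_nil; apply: (is_series_ext (fun k => 0)) => [k|]; first by rewrite big_nil.
  by apply/is_series_Reals => eps eps_gt0; exists 0%N => k _; rewrite sum_eq_R0 // R_dist_eq.
rewrite big_cons; apply: is_series_ext (is_series_plus _ _ _ _ (a_v l) IH) => k.
by rewrite big_cons.
Qed.

Lemma CV_radius_gt (a : nat -> R) x : (forall r, CV_disk a r) ->
  Rbar_lt (Rabs x) (CV_radius a).
Proof.
move=> disk; have [disk_ub _] := Lub_Rbar_correct (CV_disk a).
have := disk_ub _ (disk (Rabs x + 1)); rewrite -/(CV_radius a).
by case: (CV_radius a) => //= r; lra.
Qed.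

Section MatrixExponential.
Variable n : nat.
Implicit Types (A B X : mat n).

Lemma mpowZ r A k : mpow (r *: A)%M k = (r ^ k *: mpow A k)%M.
Proof.
elim: k => [|k IH] /=; first by mring.
by rewrite IH mmulZl mmulZr; mring.
Qed.

Lemma opnorm_mpow A k : opnorm (mpow A k) <= opnorm A ^ k.
Proof.
elim: k => [|k IH] /=; first exact: opnorm1_le1.
by apply: Rle_trans (opnorm_mul _ _) _; exact: Rmult_le_compat_l.
Qed.

Lemma Rabs_mexp_coef_le (a : R) A k : Rabs a <= opnorm (mpow A k) ->
  Rabs (a / INR (fact k)) <= opnorm A ^ k / INR (fact k).
Proof.
move=> a_le; have inv_gt0 := Rinv_0_lt_compat _ (INR_fact_lt_0 k).
rewrite /Rdiv Rabs_mult (Rabs_pos_eq (/ _)); last lra.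
apply: Rmult_le_compat_r; [lra|exact: Rle_trans a_le (opnorm_mpow A k)].
Qed.

Lemma ex_series_Rabs_mexp A i j : ex_series (fun k => Rabs (mpow A k i j / INR (fact k))).
Proof.
have exp_summable : ex_series (fun k => opnorm A ^ k / INR (fact k)).
  by eexists; exact: is_series_exp.
apply: (ex_series_le (V := R_CompleteNormedModule)) exp_summable => k.
rewrite /norm /= /abs /= Rabs_Rabsolu; apply: Rabs_mexp_coef_le.
exact: Rle_trans (Rabs_entry_le_mnorm _ i j) (mnorm_le_opnorm _).
Qed.

Lemma mexp_series A i j : is_series (fun k => mpow A k i j / INR (fact k)) (mexp A i j).
Proof.
apply/is_series_Reals; have [l l_sum] := ex_series_Rabs _ (ex_series_Rabs_mexp A i j).
exact: epsilon_spec (inhabits 0) _ (ex_intro _ l (proj1 (is_series_Reals _ _) l_sum)).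
Qed.

Arguments mexp_series : clear implicits.

Lemma mexp_comb_series A (r : 'I_n -> R) (i j : 'I_n -> 'I_n) :
  is_series (fun k => (\rsum_(l < n) (r l * mpow A k (i l) (j l))) / INR (fact k))
    (\rsum_(l < n) (r l * mexp A (i l) (j l))).
Proof.
have terms l := is_series_scal (r l) _ _ (mexp_series A (i l) (j l)).
apply: is_series_ext (is_series_rsum terms) => k.
rewrite /Rdiv big_distrl; apply: eq_bigr => l _; rewrite /scal /= /mult /=; ring.
Qed.

Arguments mexp_comb_series : clear implicits.

Lemma mexp_mulmx_series A X i j :
  is_series (fun k => (mpow A k * X)%M i j / INR (fact k)) ((mexp A * X)%M i j).
Proof.
rewrite /mmul; under eq_bigr do rewrite Rmult_comm.
apply: is_series_ext (mexp_comb_series A (fun l => X l j) (fun=> i) id) => k.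
by congr (_ / _); apply: eq_bigr => l _; rewrite Rmult_comm.
Qed.

Lemma mulmx_mexp_series A X i j :
  is_series (fun k => (X * mpow A k)%M i j / INR (fact k)) ((X * mexp A)%M i j).
Proof. exact: (mexp_comb_series A (X i) id (fun=> j)). Qed.

Lemma mapply_mexp_series A x i :
  is_series (fun k => (mpow A k *v x)%V i / INR (fact k)) ((mexp A *v x)%V i).
Proof.
rewrite /mapply; under eq_bigr do rewrite Rmult_comm.
apply: is_series_ext (mexp_comb_series A x (fun=> i) id) => k.
by congr (_ / _); apply: eq_bigr => l _; rewrite Rmult_comm.
Qed.

Arguments mexp_mulmx_series : clear implicits.
Arguments mulmx_mexp_series : clear implicits.
Arguments mapply_mexp_series : clear implicits.

Lemma opnorm_mexp A : opnorm (mexp A) <= exp (opnorm A).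
Proof.
apply: opnorm_le => // x x_le1; apply: vnorm_le => // i.
apply: is_series_abs_le (mapply_mexp_series A x i) (is_series_exp _) _ => k.
apply: Rabs_mexp_coef_le; apply: Rle_trans (Rabs_coord_le _ i) _.
exact: vnorm_mapply_ball.
Qed.

Lemma opnorm_mexpZ_le A b t : opnorm A <= b -> 0 <= t -> opnorm (mexp (t *: A)) <= exp (b * t).
Proof.
move=> A_le t_ge0; apply: Rle_trans (opnorm_mexp _) _; apply: exp_le.
by rewrite opnormZ Rabs_pos_eq // Rmult_comm; apply: Rmult_le_compat_r.
Qed.

Lemma mexp_commute A X : (A * X = X * A)%M -> (mexp A * X = X * mexp A)%M.
Proof.
move=> AX; have mpow_commute k : (mpow A k * X = X * mpow A k)%M.
  by elim: k => [|k IH] /=; rewrite ?mmul1m ?mmulm1 // -mmulA IH !mmulA AX.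
do 2 apply: functional_extensionality => ?.
rewrite -(is_series_unique _ _ (mexp_mulmx_series A X _ _)).
rewrite -(is_series_unique _ _ (mulmx_mexp_series A X _ _)).
by apply: Series_ext => k; rewrite mpow_commute.
Qed.

Lemma mexpZ_PSeries A i j t :
  mexp (t *: A) i j = PSeries (fun k => mpow A k i j / INR (fact k)) t.
Proof.
rewrite -(is_series_unique _ _ (mexp_series (t *: A) i j)).
by apply: Series_ext => k; rewrite mpowZ /mscale; field; exact: INR_fact_neq_0.
Qed.

Lemma mexp0 : mexp 0 = (1 : mat n)%M.
Proof.
rewrite (_ : 0%M = (0 *: 0)%M); last by mring.
do 2 apply: functional_extensionality => ?.
by rewrite mexpZ_PSeries PSeries_0 /=; field.
Qed.

Lemma mderiv_mexp A t : mderiv_at (fun u => mexp (u *: A)) t (A * mexp (t *: A))%M.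
Proof.
move=> i j; apply/is_derive_Reals.
have disk r : CV_disk (fun k => mpow A k i j / INR (fact k)) r.
  apply: ex_series_ext (ex_series_Rabs_mexp (r *: A) i j) => k.
  by congr Rabs; rewrite mpowZ /mscale; field; exact: INR_fact_neq_0.
apply: (is_derive_ext (PSeries (fun k => mpow A k i j / INR (fact k)))) => [u|].
  by rewrite mexpZ_PSeries.
have := is_derive_PSeries _ _ (CV_radius_gt t disk); congr is_derive.
rewrite -(is_series_unique _ _ (mulmx_mexp_series (t *: A) A i j)).
apply: Series_ext => k; rewrite /PS_derive mpowZ mmulZr /mscale fact_simpl mult_INR /=.
by field; split; [exact: INR_fact_neq_0|exact: (not_0_INR k.+1 (Nat.neq_succ_0 k))].
Qed.

Arguments mderiv_mexp : clear implicits.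

Lemma derivable_pt_lim_rsum (f : 'I_n -> R -> R) (f' : 'I_n -> R) t :
  (forall l, derivable_pt_lim (f l) t (f' l)) ->
  derivable_pt_lim (fun u => \rsum_(l < n) f l u) t (\rsum_(l < n) f' l).
Proof.
move=> deriv; elim: (index_enum _) => [|l r IH].
  rewrite big_nil; apply: (derivable_pt_lim_ext (fun=> 0)) => [u|]; first by rewrite big_nil.
  exact: derivable_pt_lim_const.
rewrite big_cons; apply: derivable_pt_lim_ext (derivable_pt_lim_plus _ _ _ _ _ (deriv l) IH) => u.
by rewrite big_cons.
Qed.

Lemma mderiv_add (F G : R -> mat n) t F' G' : mderiv_at F t F' -> mderiv_at G t G' ->
  mderiv_at (fun u => F u + G u)%M t (F' + G')%M.
Proof. by move=> dF dG i j; exact: derivable_pt_lim_plus (dF i j) (dG i j). Qed.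

Lemma mderiv_opp (F : R -> mat n) t F' :
  mderiv_at F t F' -> mderiv_at (fun u => - F u)%M t (- F')%M.
Proof. by move=> dF i j; exact: derivable_pt_lim_opp (dF i j). Qed.

Lemma mderiv_mul (F G : R -> mat n) t F' G' : mderiv_at F t F' -> mderiv_at G t G' ->
  mderiv_at (fun u => F u * G u)%M t (F' * G t + F t * G')%M.
Proof.
move=> dF dG i j; rewrite /madd /mmul -big_split.
by apply: derivable_pt_lim_rsum => l; exact: derivable_pt_lim_mult (dF i l) (dG l j).
Qed.

Lemma mderiv_mexp_line A a b t : mderiv_at (fun u => mexp ((a + b * u) *: A)) t
  (b *: (A * mexp ((a + b * t) *: A)))%M.
Proof.
move=> i j; rewrite /mscale Rmult_comm.
apply: (derivable_pt_lim_comp (fun u => a + b * u) (fun u => mexp (u *: A) i j)).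
  by apply/is_derive_Reals; auto_derive => //; ring.
exact: mderiv_mexp.
Qed.

Arguments mderiv_mexp_line : clear implicits.

Definition mexp_orbit A t0 X t := (mexp ((t - t0) *: A) * X)%M.

Lemma mexp_orbit_start A t0 X : mexp_orbit A t0 X t0 = X.
Proof. by rewrite -[RHS]mmul1m -mexp0; congr (mexp _ * _)%M; mring. Qed.

Lemma mderiv_mexp_orbit A t0 X t : mderiv_at (mexp_orbit A t0 X) t (A * mexp_orbit A t0 X t)%M.
Proof.
have orbitE : mexp_orbit A t0 X = fun u => (mexp ((- t0 + 1 * u) *: A) * X)%M.
  by apply: functional_extensionality => u; congr (mexp _ * _)%M; mring.
have const_X : mderiv_at (fun=> X) t 0 by move=> i j; exact: derivable_pt_lim_const.
have := mderiv_mul (mderiv_mexp_line A (- t0) 1 t) const_X.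
by rewrite orbitE; congr mderiv_at; rewrite mmulm0 mmulZl mmulA; mring.
Qed.

Lemma mderiv_zero_const (F : R -> mat n) a b : (forall t, mderiv_at F t 0) -> F a = F b.
Proof.
move=> dF; do 2 apply: functional_extensionality => ?.
wlog ab : a b / a < b.
  by move=> lt_case; case: (Rtotal_order a b) => [|[->|]] // /lt_case.
apply: (eq_is_derive (fun u => F u _ _)) ab => t _; apply/is_derive_Reals.
exact: dF.
Qed.

Lemma opnorm_mean_value (F F' : R -> mat n) a b c : a <= b ->
  (forall t, a <= t <= b -> mderiv_at F t (F' t)) ->
  (forall t, a <= t <= b -> opnorm (F' t) <= c) -> opnorm (F b - F a) <= c * (b - a).
Proof.
move=> ab dF F'_le; have ba_ge0 : 0 <= b - a by lra.
have c_ge0 : 0 <= c by apply: Rle_trans (opnorm_ge0 (F' a)) _; apply: F'_le; lra.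
case: ab => [ab|<-]; last by rewrite opnorm_subxx; lra.
apply: opnorm_le => [|x x_le1]; first exact: Rmult_le_pos.
apply: vnorm_le => [|i]; first exact: Rmult_le_pos.
have deriv t : a <= t <= b -> derivable_pt_lim (fun u => (F u *v x)%V i) t ((F' t *v x)%V i).
  move=> /dF dFt; apply: derivable_pt_lim_rsum => l.
  exact: derivable_pt_lim_scal_right.
have [t [increment t_in]] := MVT_cor2 _ _ _ _ ab deriv.
rewrite mapplyBl {1}/vadd /vopp -/(Rminus _ _) increment Rabs_mult (Rabs_pos_eq (b - a)) //.
apply: Rmult_le_compat_r => //; apply: Rle_trans (Rabs_coord_le _ i) _.
by apply: Rle_trans (vnorm_mapply_ball _ x_le1) _; apply: F'_le; lra.
Qed.

Lemma mexp_opp_mul_solution A (F : R -> mat n) t : (forall u, mderiv_at F u (A * F u)%M) ->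
  (mexp ((- t) *: A) * F t)%M = F 0.
Proof.
move=> dF; pose H u := (mexp ((0 + -1 * u) *: A) * F u)%M.
have dH u : mderiv_at H u 0.
  have := mderiv_mul (mderiv_mexp_line A 0 (-1) u) (dF u); congr mderiv_at.
  have -> : (mexp ((0 + -1 * u) *: A) * (A * F u) = A * mexp ((0 + -1 * u) *: A) * F u)%M.
    by rewrite mmulA mexp_commute // mmulZl mmulZr.
  by rewrite mmulZl; mring.
have := mderiv_zero_const t 0 dH; rewrite /H !Rplus_0_l Rmult_0_r.
have -> : -1 * t = - t by ring.
by rewrite (_ : 0 *: A = 0)%M ?mexp0 ?mmul1m //; mring.
Qed.

Lemma mexpNK A t : (mexp ((- t) *: A) * mexp (t *: A) = 1)%M.
Proof.
rewrite (mexp_opp_mul_solution (F := fun u => mexp (u *: A)) _ (mderiv_mexp A)).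
by rewrite (_ : 0 *: A = 0)%M ?mexp0 //; mring.
Qed.

Lemma mexpD A s t : mexp ((s + t) *: A) = (mexp (s *: A) * mexp (t *: A))%M.
Proof.
have solution u : mderiv_at (fun u => mexp ((t + 1 * u) *: A)) u (A * mexp ((t + 1 * u) *: A))%M.
  by have := mderiv_mexp_line A t 1 u; congr mderiv_at; mring.
have := mexp_opp_mul_solution s solution; rewrite Rmult_0_r Rplus_0_r => <-.
have := mexpNK A (- s); rewrite Ropp_involutive => expK.
by rewrite mmulA expK mmul1m Rmult_1_l Rplus_comm.
Qed.

(* Differentiate [exp ((1 - u) B) exp (u A)] from [u = 0] to [u = 1]. *)
Lemma opnorm_mexp_sub A B b : opnorm A <= b -> opnorm B <= b ->
  opnorm (mexp A - mexp B) <= exp b * opnorm (A - B).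
Proof.
move=> A_le B_le; pose EA u := mexp ((0 + 1 * u) *: A)%M; pose EB u := mexp ((1 + -1 * u) *: B)%M.
pose F u := (EB u * EA u)%M.
pose F' u := (EB u * ((A - B) * EA u))%M.
have dF u : 0 <= u <= 1 -> mderiv_at F u (F' u).
  move=> _; have := mderiv_mul (mderiv_mexp_line B 1 (-1) u) (mderiv_mexp_line A 0 1 u).
  congr mderiv_at; rewrite /F' mmulBl mmulBr mmulZl mmulZr -/(EA u) -/(EB u).
  have -> : (B * EB u = EB u * B)%M by rewrite mexp_commute // mmulZl mmulZr.
  by rewrite -!mmulA; mring.
have F'_le u : 0 <= u <= 1 -> opnorm (F' u) <= exp b * opnorm (A - B).
  move=> u01.
  have EB_le : opnorm (EB u) <= exp (b * (1 + -1 * u)) by apply: opnorm_mexpZ_le; lra.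
  have EA_le : opnorm (EA u) <= exp (b * (0 + 1 * u)) by apply: opnorm_mexpZ_le; lra.
  rewrite (_ : exp b = exp (b * (1 + -1 * u)) * exp (b * (0 + 1 * u))); last first.
    by rewrite -exp_plus; congr exp; ring.
  rewrite Rmult_assoc; apply: Rle_trans (opnorm_mul _ _) _; apply: Rmult_le_compat => //.
  rewrite Rmult_comm; apply: Rle_trans (opnorm_mul _ _) _.
  exact: Rmult_le_compat_l.
have F1 : F 1 = mexp A.
  by rewrite -[RHS]mmul1m -mexp0; congr (mexp _ * mexp _)%M; mring.
have F0 : F 0 = mexp B.
  by rewrite -[RHS]mmulm1 -mexp0; congr (mexp _ * mexp _)%M; mring.
by have := opnorm_mean_value Rle_0_1 dF F'_le; rewrite F1 F0 Rminus_0_r Rmult_1_r.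
Qed.

Lemma opnorm_mexp_sub1 A b : opnorm A <= b -> opnorm (mexp A - 1) <= exp b * b.
Proof.
move=> A_le; have b_ge0 := Rle_trans _ _ _ (opnorm_ge0 A) A_le.
have zero_le : opnorm (0 : mat n) <= b.
  by rewrite (_ : 0 = 0 *: 0)%M ?opnormZ ?Rabs_R0 ?Rmult_0_l //; mring.
have := opnorm_mexp_sub A_le zero_le; rewrite mexp0 => sub_le; apply: Rle_trans sub_le _.
apply: Rmult_le_compat_l => //.
by rewrite (_ : A - 0 = A)%M //; mring.
Qed.

End MatrixExponential.

(** * Products of exponentials *)

Inductive exp_St n (M : mat n -> Prop) : R -> mat n -> Prop :=
| exp_St_nil : exp_St M 0 1
| exp_St_cons h A t X : 0 <= h -> M A -> exp_St M t X ->
    exp_St M (h + t) (mexp (h *: A) * X).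

Section ExponentialProducts.
Variable n : nat.
Implicit Types (M N : mat n -> Prop) (A B X Y : mat n).

Lemma exp_St_ge0 M t X : exp_St M t X -> 0 <= t.
Proof. by elim=> [|h A s Y *]; lra. Qed.

Lemma exp_St_exp M t A : 0 <= t -> M A -> exp_St M t (mexp (t *: A)).
Proof.
move=> t_ge0 MA; have := exp_St_cons t_ge0 MA (exp_St_nil M).
by rewrite Rplus_0_r mmulm1.
Qed.

Lemma exp_St_nonempty M t : 0 <= t -> nonempty M -> nonempty (exp_St M t).
Proof. by move=> t_ge0 [A MA]; exists (mexp (t *: A)); exact: exp_St_exp. Qed.

Lemma exp_St_mul M s t X Y : exp_St M s X -> exp_St M t Y -> exp_St M (s + t) (X * Y).
Proof.
move=> MX MY; elim: MX => [|h A r Z h_ge0 MA _ IH]; first by rewrite Rplus_0_l mmul1m.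
by rewrite Rplus_assoc -mmulA; exact: exp_St_cons.
Qed.

Lemma exp_St_split M s t X : 0 <= s -> 0 <= t -> exp_St M (s + t) X ->
  exists Y Z, exp_St M s Y /\ exp_St M t Z /\ X = (Y * Z)%M.
Proof.
move=> s_ge0 t_ge0; move r_eq: (s + t) => r MX.
elim: MX s s_ge0 r_eq => [|h A r' Z h_ge0 MA MZ IH] s s_ge0 r_eq.
  have [-> ->] : s = 0 /\ t = 0 by lra.
  by exists 1%M, 1%M; rewrite mmul1m; do 2 (split; first exact: exp_St_nil).
case: (Rle_dec h s) => [hs|/Rnot_le_lt sh].
  have [||Y [W [MY [MW ->]]]] := IH (s - h); [lra|lra|].
  exists (mexp (h *: A) * Y)%M, W; rewrite mmulA; split=> //.
  by rewrite (_ : s = h + (s - h)); [exact: exp_St_cons|ring].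
exists (mexp (s *: A)), (mexp ((h - s) *: A) * Z)%M; split; first exact: exp_St_exp.
split; last by rewrite mmulA -mexpD; congr (mexp _ * _)%M; mring.
by rewrite (_ : t = (h - s) + r'); [apply: exp_St_cons => //|]; lra.
Qed.

Lemma exp_St_time0 M X : exp_St M 0 X -> X = 1%M.
Proof.
move t_eq0: 0 => t MX; elim: MX t_eq0 => [//|h A s Y h_ge0 _ MY IH] t_eq0.
have [-> s_eq0] : h = 0 /\ 0 = s by have := exp_St_ge0 MY; lra.
by rewrite (IH s_eq0) mmulm1 (_ : 0 *: A = 0)%M ?mexp0 //; mring.
Qed.

Lemma disc_St_exp_St M t k X : 0 <= t ->
  disc_St (exp_St M t) k X <-> exp_St M (INR k * t) X.
Proof.
move=> t_ge0; elim: k X => [|k IH] X.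
  by rewrite Rmult_0_l; split=> [->|/exp_St_time0 //]; exact: exp_St_nil.
have -> : INR k.+1 * t = t + INR k * t by rewrite S_INR; ring.
split=> [[A [P [MA [/IH MP ->]]]]|]; first exact: exp_St_mul.
move=> /(exp_St_split t_ge0 (Rmult_le_pos _ _ (pos_INR k) t_ge0))[Y [Z [MY [/IH MZ ->]]]].
by exists Y, Z.
Qed.

Lemma exp_St_in_pi K M t X : (forall A, M A -> in_pi_exp K A) -> exp_St M t X -> in_pi K X.
Proof.
move=> M_pos; elim=> [|h A s Y h_ge0 MA _ IH]; first exact: in_pi1.
by apply: in_pi_mul => //; exact: M_pos.
Qed.

Lemma opnorm_exp_St M b t : opnorm_bounded b M -> opnorm_bounded (exp (b * t)) (exp_St M t).
Proof.
move=> M_le X; elim=> [|h A s Y h_ge0 /M_le A_le _ IH].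
  by rewrite Rmult_0_r exp_0; exact: opnorm1_le1.
rewrite Rmult_plus_distr_l exp_plus; apply: Rle_trans (opnorm_mul _ _) _.
by apply: Rmult_le_compat => //; exact: opnorm_mexpZ_le.
Qed.

Lemma exp_St_within M N b h t : opnorm_bounded b M -> opnorm_bounded b N -> 0 <= h ->
  within h M N -> within (t * exp (b * t) * h) (exp_St M t) (exp_St N t).
Proof.
move=> M_le N_le h_ge0 MN X; elim=> [|r A s Y r_ge0 MA MY [Z [NZ YZ]]].
  by exists 1%M; rewrite opnorm_subxx; split; [exact: exp_St_nil|lra].
have [B [NB AB]] := MN A MA.
exists (mexp (r *: B) * Z)%M; split; first exact: exp_St_cons.
rewrite (_ : mexp (r *: A) * Y - _ =
  mexp (r *: B) * (Y - Z) + (mexp (r *: A) - mexp (r *: B)) * Y)%M; last first.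
  by rewrite mmulBr mmulBl; mring.
apply: Rle_trans (opnorm_triangle _ _) _.
have transported_le : opnorm (mexp (r *: B) * (Y - Z)) <= exp (b * r) * (s * exp (b * s) * h).
  apply: Rle_trans (opnorm_mul _ _) _; apply: Rmult_le_compat => //.
  by apply: opnorm_mexpZ_le => //; exact: N_le.
have exp_sub_le : opnorm (mexp (r *: A) - mexp (r *: B)) <= exp (b * r) * (r * h).
  have scaled (C : mat n) : opnorm C <= b -> opnorm (r *: C) <= b * r.
    move=> C_le; rewrite opnormZ Rabs_pos_eq // Rmult_comm; exact: Rmult_le_compat_r.
  apply: Rle_trans (opnorm_mexp_sub (scaled _ (M_le A MA)) (scaled _ (N_le B NB))) _.
  apply: Rmult_le_compat_l => //.
  rewrite (_ : r *: A - r *: B = r *: (A - B))%M; last by mring.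
  by rewrite opnormZ Rabs_pos_eq //; exact: Rmult_le_compat_l.
have replaced_le : opnorm ((mexp (r *: A) - mexp (r *: B)) * Y) <=
    exp (b * r) * (r * h) * exp (b * s).
  apply: Rle_trans (opnorm_mul _ _) _; apply: Rmult_le_compat => //.
  exact: (opnorm_exp_St M_le MY).
apply: Rle_trans (Rplus_le_compat _ _ _ _ transported_le replaced_le) _.
by apply: Req_le; rewrite Rmult_plus_distr_l exp_plus; ring.
Qed.

End ExponentialProducts.

Lemma null_set_sub (E F : R -> Prop) : (forall x, E x -> F x) -> null_set F -> null_set E.
Proof.
move=> EF F_null eps /F_null[a [b [cover rest]]].
by exists a, b; split=> // x /EF; exact: cover.
Qed.

Lemma null_set_empty (E : R -> Prop) : (forall x, ~ E x) -> null_set E.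
Proof.
move=> E_empty eps eps_gt0; exists (fun=> 0), (fun=> 0); split; first by move=> x /E_empty.
by split=> [k|N]; [lra|rewrite sum_cte; lra].
Qed.

Lemma null_set_add (E : R -> Prop) p : null_set E -> null_set (fun x => E x \/ x = p).
Proof.
move=> E_null eps eps_gt0; have [|a [b [cover [ab len_le]]]] := E_null (eps / 2); first lra.
exists (fun k => if k is k'.+1 then a k' else p - eps / 4).
exists (fun k => if k is k'.+1 then b k' else p + eps / 4); split; [|split].
- by move=> x [/cover[k x_in]|->]; [exists k.+1|exists 0%N; lra].
- by case=> [|k]; [lra|exact: ab].
case=> [|N]; first by rewrite /=; lra.
by rewrite decomp_sum /=; [have := len_le N; lra|lia].
Qed.

Definition glue T c (F G : R -> T) t := if Rle_dec t c then F t else G t.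

Lemma glue_left T c (F G : R -> T) t : t <= c -> glue c F G t = F t.
Proof. by rewrite /glue; case: Rle_dec. Qed.

Lemma glue_right T c (F G : R -> T) t : c < t -> glue c F G t = G t.
Proof. by rewrite /glue; case: Rle_dec => //= tc ct; lra. Qed.

Section LipschitzSolutions.
Variable n : nat.
Implicit Types (M : mat n -> Prop) (A X : mat n) (F G : R -> mat n).

Definition lipschitz_on (F : R -> mat n) L a b := forall s t, a <= s -> s <= t -> t <= b ->
  opnorm (F t - F s) <= L * (t - s).

Lemma lipschitz_on_abs_cont F L t : 0 <= L -> lipschitz_on F L 0 t -> abs_cont_on F t.
Proof.
move=> L_ge0 F_lip eps eps_gt0.
have quot_gt0 : 0 < eps / (L + 1) by apply: Rdiv_lt_0_compat; lra.
exists (eps / (L + 1)); split=> // m a b ab_in _ len_lt.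
apply: Rle_lt_trans (_ : L * (\rsum_(k < m) (b k - a k)) < eps).
  rewrite big_distrr; apply: rsum_le => k; have [? [? ?]] := ab_in k (ltn_ord k).
  by apply: Rle_trans (mnorm_le_opnorm _) _; exact: F_lip.
apply: Rle_lt_trans (_ : L * (eps / (L + 1)) < _).
  by apply: Rmult_le_compat_l => //; exact: Rlt_le.
by have : (L + 1) * (eps / (L + 1)) = eps by [field; lra]; lra.
Qed.

Lemma lipschitz_on_glue F G L L' a b c : F c = G c ->
  lipschitz_on F L a c -> lipschitz_on G L' c b -> lipschitz_on (glue c F G) (Rmax L L') a b.
Proof.
move=> FG F_lip G_lip s t a_s st t_b; have ts_ge0 : 0 <= t - s by lra.
have [L_le L'_le] := (Rmax_l L L', Rmax_r L L').
have [tc|ct] := Rle_lt_dec t c.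
  rewrite !glue_left; [|lra|lra]; apply: Rle_trans (F_lip s t a_s st tc) _.
  exact: Rmult_le_compat_r.
have [sc|cs] := Rle_lt_dec s c; last first.
  rewrite !glue_right //; apply: Rle_trans (G_lip s t _ st t_b) _; first lra.
  exact: Rmult_le_compat_r.
rewrite glue_right // glue_left //; apply: Rle_trans (opnorm_sub_triangle (G c) _ _) _.
have right_le := G_lip c t (Rle_refl c) (Rlt_le _ _ ct) t_b.
have left_le := F_lip s c a_s sc (Rle_refl c); rewrite FG in left_le.
have [tc_ge0 cs_ge0] : 0 <= t - c /\ 0 <= c - s by lra.
have := Rmult_le_compat_r _ _ _ tc_ge0 L'_le; have := Rmult_le_compat_r _ _ _ cs_ge0 L_le.
lra.
Qed.

Lemma mderiv_glue_left F G c t D : t < c -> mderiv_at F t D -> mderiv_at (glue c F G) t D.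
Proof.
move=> tc dF i j.
apply: (@derivable_pt_lim_locally_ext (fun u => F u i j) _ _ (t - 1) c); [lra| |exact: dF].
by move=> u u_in; rewrite glue_left //; lra.
Qed.

Lemma mderiv_glue_right F G c t D : c < t -> mderiv_at G t D -> mderiv_at (glue c F G) t D.
Proof.
move=> ct dG i j.
apply: (@derivable_pt_lim_locally_ext (fun u => G u i j) _ _ c (t + 1)); [lra| |exact: dG].
by move=> u u_in; rewrite glue_right //; lra.
Qed.

Lemma lipschitz_on_mexp_orbit A X t0 t1 : lipschitz_on (mexp_orbit A t0 X)
  (opnorm A * (exp (opnorm A * (t1 - t0)) * opnorm X)) t0 t1.
Proof.
move=> s t t0s st tt1; apply: opnorm_mean_value st _ _ => u u_in.
  exact: mderiv_mexp_orbit.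
apply: Rle_trans (opnorm_mul _ _) _; apply: Rmult_le_compat_l => //.
apply: Rle_trans (opnorm_mul _ _) _; apply: Rmult_le_compat_r => //.
apply: Rle_trans (opnorm_mexpZ_le (Rle_refl _) _) _; first lra.
by apply: exp_le; apply: Rmult_le_compat_l => //; lra.
Qed.

Definition lipschitz_St M (t : R) X := exists (sigma Phi : R -> mat n) L,
  0 <= L /\ (forall s, 0 <= s <= t -> M (sigma s)) /\ Phi 0 = 1%M /\ lipschitz_on Phi L 0 t /\
  null_set (fun s => 0 < s < t /\ ~ mderiv_at Phi s (sigma s * Phi s)%M) /\ X = Phi t.

Lemma lipschitz_St_cont_St M t X : lipschitz_St M t X -> cont_St M t X.
Proof.
move=> [sigma [Phi [L [L_ge0 [sigma_in [Phi0 [Phi_lip rest]]]]]]]; exists sigma, Phi.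
by do 2 split=> //; split; first exact: lipschitz_on_abs_cont Phi_lip.
Qed.

Lemma lipschitz_St_cons M h A t X : 0 <= t -> 0 <= h -> M A ->
  lipschitz_St M t X -> lipschitz_St M (h + t) (mexp (h *: A) * X).
Proof.
move=> t_ge0 h_ge0 MA [sigma [Phi [L [L_ge0 [sigma_in [Phi0 [Phi_lip [null ->]]]]]]]].
pose Psi := mexp_orbit A t (Phi t).
have Psi_t : Psi t = Phi t by exact: mexp_orbit_start.
have Psi_end : Psi (h + t) = (mexp (h *: A) * Phi t)%M.
  by congr (mexp _ * _)%M; mring.
exists (glue t sigma (fun=> A)), (glue t Phi Psi).
exists (Rmax L (opnorm A * (exp (opnorm A * (h + t - t)) * opnorm (Phi t)))).
split; first exact: Rle_trans L_ge0 (Rmax_l _ _).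
split.
  move=> s s_in; have [st|ts] := Rle_lt_dec s t; last by rewrite glue_right.
  by rewrite glue_left //; apply: sigma_in; lra.
split; first by rewrite glue_left.
split; first by apply: lipschitz_on_glue Phi_lip _ => //; exact: lipschitz_on_mexp_orbit.
split; last first.
  have [h_gt0|h_eq0] : 0 < h \/ h = 0 by lra.
    by rewrite glue_right ?Psi_end //; lra.
  by rewrite -Psi_end glue_left h_eq0 Rplus_0_l ?Psi_t //; lra.
apply: null_set_sub (null_set_add t null) => s [s_in not_deriv].
have [st|[->|ts]] := Rtotal_order s t; [left|by right|case: not_deriv].
  split; first lra; move=> deriv; apply: not_deriv.
  by apply: mderiv_glue_left => //; rewrite !glue_left; try lra.
by apply: mderiv_glue_right => //; rewrite !glue_right //; exact: mderiv_mexp_orbit.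
Qed.

Lemma exp_St_cont_St M t X : nonempty M -> exp_St M t X -> cont_St M t X.
Proof.
move=> [A0 MA0] MX; apply: lipschitz_St_cont_St.
elim: MX => [|h A s Y h_ge0 MA MY]; last exact: lipschitz_St_cons (exp_St_ge0 MY) h_ge0 MA.
exists (fun=> A0), (fun=> 1%M), 0; split; first lra.
do 2 split=> //; split; first by move=> *; rewrite opnorm_subxx; lra.
by split=> //; apply: null_set_empty => s; lra.
Qed.

End LipschitzSolutions.

(** * Absolutely continuous functions with nonpositive slope almost everywhere *)

Definition clip a b x := Rmin (Rmax x a) b.

Lemma clip_le a b x y : x <= y -> clip a b x <= clip a b y.
Proof. by move=> xy; apply: Rle_min_compat_r; exact: Rle_max_compat_r. Qed.

Lemma clip_bounds a b x : a <= b -> a <= clip a b x <= b.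
Proof. by move=> ab; split; [apply: Rmin_glb => //; exact: Rmax_r|exact: Rmin_r]. Qed.

Lemma clip_id a b x : a < x < b -> clip a b x = x.
Proof. by move=> ab; rewrite /clip Rmax_left ?Rmin_left; lra. Qed.

(* Total length of the parts in [[0, x]] of the first [J + 1] intervals. *)
Definition cover_len (a b : nat -> R) J x :=
  sum_f_R0 (fun j => clip (a j) (b j) x - clip (a j) (b j) 0) J.

Section CoverLength.
Variables a b : nat -> R.

Lemma cover_len_mono J x y : x <= y -> cover_len a b J x <= cover_len a b J y.
Proof. by move=> xy; apply: sum_Rle => j _; have := clip_le (a j) (b j) xy; lra. Qed.

Lemma cover_len_ge0 J x : 0 <= x -> 0 <= cover_len a b J x.
Proof. by move=> x_ge0; apply: cond_pos_sum => j; have := clip_le (a j) (b j) x_ge0; lra. Qed.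

Lemma cover_len_widen J J' x : 0 <= x -> (J <= J')%N -> cover_len a b J x <= cover_len a b J' x.
Proof.
move=> x_ge0; elim: J' => [|J' IH]; first by rewrite leqn0 => /eqP->; lra.
rewrite leq_eqVlt => /orP[/eqP->|]; first lra.
rewrite ltnS => /IH; rewrite [cover_len _ _ J'.+1 x]tech5 -/(cover_len a b J' x).
by have := clip_le (a J'.+1) (b J'.+1) x_ge0; lra.
Qed.

Lemma cover_len_step J j x y : (j <= J)%N -> x <= y -> a j < x -> y < b j ->
  cover_len a b J x + (y - x) <= cover_len a b J y.
Proof.
move=> jJ xy ax yb.
have step_j : clip (a j) (b j) y - clip (a j) (b j) x = y - x by rewrite !clip_id; lra.
elim: J jJ => [|J IH]; first by rewrite leqn0 /cover_len /= => /eqP <-; lra.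
rewrite ![cover_len _ _ J.+1 _]tech5 -!/(cover_len a b J _) leq_eqVlt => /orP[/eqP <-|].
  by have := cover_len_mono J xy; lra.
by rewrite ltnS => /IH; have := clip_le (a J.+1) (b J.+1) xy; lra.
Qed.

Lemma cover_len_le J x : (forall k, a k <= b k) ->
  cover_len a b J x <= sum_f_R0 (fun k => b k - a k) J.
Proof.
move=> ab; apply: sum_Rle => j _.
by have := clip_bounds x (ab j); have := clip_bounds 0 (ab j); lra.
Qed.

End CoverLength.

Definition ordered_intervals (a b : nat -> R) m x :=
  (forall k, (k < m)%N -> 0 <= a k /\ a k <= b k /\ b k <= x) /\
  (forall k, (k.+1 < m)%N -> b k <= a k.+1).

Definition extend (a : nat -> R) m x k := if (k < m)%N then a k else x.

Lemma ordered_intervals_widen a b m x y :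
  x <= y -> ordered_intervals a b m x -> ordered_intervals a b m y.
Proof. by move=> xy [ab_in ab_ord]; split=> // k /ab_in; lra. Qed.

Lemma ordered_intervals_extend a b m x y : 0 <= x <= y -> ordered_intervals a b m x ->
  ordered_intervals (extend a m x) (extend b m y) m.+1 y.
Proof.
move=> xy [ab_in ab_ord]; split=> k; rewrite /extend.
  by move=> _; case: ltnP => [/ab_in|_]; lra.
rewrite ltnS => km; rewrite km; case: ltnP => [|_]; first exact: ab_ord.
by have := ab_in k km; lra.
Qed.

Lemma rsum_extend (f : R -> R -> R) a b m x y :
  \rsum_(k < m.+1) f (extend a m x k) (extend b m y k) =
  \rsum_(k < m) f (a k) (b k) + f x y.
Proof.
rewrite big_ord_recr /= /extend ltnn; congr (_ + _).
by apply: eq_bigr => k _; rewrite ltn_ord.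
Qed.

Definition abs_cont_above (g : R -> R) t := forall eps, 0 < eps -> exists delta, 0 < delta /\
  forall m a b, ordered_intervals a b m t -> \rsum_(k < m) (b k - a k) < delta ->
  \rsum_(k < m) (g (b k) - g (a k)) < eps.

Definition slope_nonpos (g : R -> R) t s := forall eps, 0 < eps -> exists d, 0 < d /\
  forall x y, 0 <= x <= s -> s <= y <= t -> s - d < x -> y < s + d ->
  g y - g x <= eps * (y - x).

(* Along a partition of [[0, x]], [g] increases with slope at most [eps] except on the
   intervals [[a' k, b' k]], whose total length is charged to the cover. *)
Definition increase_covered g eps (a b : nat -> R) x := exists m a' b' J,
  ordered_intervals a' b' m x /\ \rsum_(k < m) (b' k - a' k) <= cover_len a b J x /\
  g x <= g 0 + eps * x + \rsum_(k < m) (g (b' k) - g (a' k)).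

Section NonposSlope.
Variables (g : R -> R) (t : R).
Hypothesis t_ge0 : 0 <= t.

Lemma increase_covered0 eps a b : increase_covered g eps a b 0.
Proof.
exists 0%N, (fun=> 0), (fun=> 0), 0%N; rewrite !big_ord0; split=> //.
by split; [apply: cover_len_ge0; lra|lra].
Qed.

Lemma increase_covered_slope eps a b x y : x <= y -> g y - g x <= eps * (y - x) ->
  increase_covered g eps a b x -> increase_covered g eps a b y.
Proof.
move=> xy slope_le [m [a' [b' [J [intervals [len_le increase_le]]]]]].
exists m, a', b', J; split; first exact: ordered_intervals_widen intervals.
by split; [have := cover_len_mono a b J xy; lra|lra].
Qed.

Lemma increase_covered_interval eps a b j x y : 0 <= eps -> 0 <= x <= y ->
  a j < x -> y < b j -> increase_covered g eps a b x -> increase_covered g eps a b y.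
Proof.
move=> eps_ge0 xy ax yb [m [a' [b' [J [intervals [len_le increase_le]]]]]].
exists m.+1, (extend a' m x), (extend b' m y), (maxn J j).
split; first exact: ordered_intervals_extend.
rewrite (rsum_extend (fun u v => v - u)) (rsum_extend (fun u v => g v - g u)).
split; last by have := Rmult_le_compat_l _ _ _ eps_ge0 xy.2; lra.
apply: Rle_trans (cover_len_step (leq_maxr J j) xy.2 ax yb).
by have := cover_len_widen a b xy.1 (leq_maxl J j); lra.
Qed.

Lemma increase_covered_end eps a b : 0 < eps ->
  (forall s, 0 <= s <= t -> slope_nonpos g t s \/ exists k, a k < s < b k) ->
  increase_covered g eps a b t.
Proof.
move=> eps_gt0 slope_or_cover; apply: Cousin_induction t_ge0 (increase_covered0 _ _ _) _.
move=> s /slope_or_cover[/(_ eps eps_gt0)[d [d_gt0 slope_le]]|[j aj_bj]].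
  exists d; split=> // x y xs sy sd ds; apply: increase_covered_slope; first lra.
  exact: slope_le.
exists (Rmin (s - a j) (b j - s)); split; first by apply: Rmin_pos; lra.
have [min_a min_b] := (Rmin_l (s - a j) (b j - s), Rmin_r (s - a j) (b j - s)).
by move=> x y xs sy sd ds; apply: (increase_covered_interval (j := j)); lra.
Qed.

Lemma ae_slope_nonpos_le : abs_cont_above g t ->
  null_set (fun s => 0 < s < t /\ ~ slope_nonpos g t s) -> g t <= g 0.
Proof.
move=> g_ac exceptional_null; apply: le_epsilon => eps eps_gt0.
have eps2_gt0 : 0 < eps / 2 by lra.
have slope_eps_gt0 : 0 < eps / 2 / (t + 1) by apply: Rdiv_lt_0_compat; lra.
have [delta [delta_gt0 increase_lt]] := g_ac _ eps2_gt0.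
have delta2_gt0 : 0 < delta / 2 by lra.
have [a [b [cover [ab len_le]]]] := null_set_add t (null_set_add 0 exceptional_null) delta2_gt0.
have [s s_in|m [a' [b' [J [intervals [len_J increase_le]]]]]] :=
    increase_covered_end (a := a) (b := b) slope_eps_gt0.
  case: (classic (slope_nonpos g t s)) => [|no_slope]; first by left.
  right; apply: cover; have [->|[->|s_inside]] : s = 0 \/ s = t \/ 0 < s < t by lra.
  - by left; right.
  - by right.
  by left; left.
have increments_lt : \rsum_(k < m) (g (b' k) - g (a' k)) < eps / 2.
  apply: increase_lt intervals _.
  by have := cover_len_le J t ab; have := len_le J; lra.
have : eps / 2 / (t + 1) * t <= eps / 2.
  rewrite [X in _ <= X](_ : _ = eps / 2 / (t + 1) * (t + 1)); last by field; lra.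
  by apply: Rmult_le_compat_l; lra.
lra.
Qed.

End NonposSlope.

(** * Approximation of Caratheodory solutions *)

Lemma common_radius (I : finType) (P : I -> R -> Prop) :
  (forall i d d', 0 < d' <= d -> P i d -> P i d') ->
  (forall i, exists d, 0 < d /\ P i d) -> exists d, 0 < d /\ forall i, P i d.
Proof.
move=> P_shrink P_ex.
suff [d [d_gt0 Pd]] : exists d, 0 < d /\ forall i, i \in enum I -> P i d.
  by exists d; split=> // i; apply: Pd; rewrite mem_enum.
elim: (enum I) => [|i s [d [d_gt0 IH]]]; first by exists 1; split; [lra|].
have [d' [d'_gt0 Pd']] := P_ex i.
exists (Rmin d' d); split=> [|j]; first exact: Rmin_pos.
have min_gt0 := Rmin_pos _ _ d'_gt0 d_gt0.
rewrite inE => /orP[/eqP->|/IH Pj]; first exact: P_shrink (conj min_gt0 (Rmin_l _ _)) Pd'.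
exact: P_shrink (conj min_gt0 (Rmin_r _ _)) Pj.
Qed.

Lemma mderiv_at_expansion n (F : R -> mat n) s D eps : mderiv_at F s D -> 0 < eps ->
  exists d, 0 < d /\ forall u, Rabs (u - s) < d ->
    opnorm (F u - F s - (u - s) *: D) <= eps * Rabs (u - s).
Proof.
move=> dF eps_gt0; have n1_gt0 : 0 < INR n + 1 by have := pos_INR n; lra.
pose eps' := eps / (INR n + 1); have eps'_gt0 : 0 < eps' by exact: Rdiv_lt_0_compat.
pose P (p : 'I_n * 'I_n) d := forall u, Rabs (u - s) < d ->
  Rabs ((F u - F s - (u - s) *: D)%M p.1 p.2) <= eps' * Rabs (u - s).
have [p d d' d'_le Pd u us|[i j]|d [d_gt0 Pd]] := @common_radius _ P.
- by apply: Pd; lra.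
- have [d quotient_near] := dF i j eps' eps'_gt0.
  exists d; split=> [|u us]; first exact: cond_pos.
  rewrite /= /madd /mopp /mscale; case: (Req_dec (u - s) 0) => [us0|us_neq0].
    have -> : u = s by lra.
    by rewrite (_ : F s i j + _ + _ = 0) ?Rabs_R0; [have := Rabs_pos (s - s); nra|ring].
  have := quotient_near _ us_neq0 us; have -> : s + (u - s) = u by ring.
  move=> /Rlt_le/(Rmult_le_compat_r _ _ _ (Rabs_pos (u - s))).
  by rewrite -Rabs_mult; congr (Rabs _ <= _); field.
exists d; split=> // u us; apply: Rle_trans (opnorm_le_mnorm _) _.
rewrite (_ : eps = (INR n + 1) * eps'); last by rewrite /eps'; field; lra.
have rhs_ge0 : 0 <= eps' * Rabs (u - s).
  by apply: Rmult_le_pos; [lra|exact: Rabs_pos].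
rewrite Rmult_assoc; apply: Rmult_le_compat => //; first lra.
by apply: mnorm_le => // i j; exact: (Pd (i, j)).
Qed.

Definition opdist n (A : mat n) (S : mat n -> Prop) :=
  Rinf (fun r => exists B, S B /\ r = opnorm (A - B)).

Section SetDistance.
Variables (n : nat) (A : mat n) (S : mat n -> Prop).
Hypothesis S_nonempty : nonempty S.

Lemma opdist_is_glb : (forall B, S B -> opdist A S <= opnorm (A - B)) /\
  (forall l, (forall B, S B -> l <= opnorm (A - B)) -> l <= opdist A S).
Proof.
have [|r [B [_ ->]]|lower greatest] :=
  @Rinf_is_glb (fun r => exists B, S B /\ r = opnorm (A - B)) 0.
- by have [B SB] := S_nonempty; exists (opnorm (A - B)), B.
- exact: opnorm_ge0.
split=> [B SB|l l_le]; first by apply: lower; exists B.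
by apply: greatest => r [B [SB ->]]; exact: l_le.
Qed.

End SetDistance.

Lemma mderiv_at_exp_expansion n (Phi : R -> mat n) A s eps :
  mderiv_at Phi s (A * Phi s)%M -> 0 < eps -> exists d, 0 < d /\ forall u, Rabs (u - s) < d ->
    opnorm (Phi u - mexp_orbit A s (Phi s) u) <= eps * Rabs (u - s).
Proof.
move=> dPhi eps_gt0; pose G u := (Phi u - mexp_orbit A s (Phi s) u)%M.
have Gs : G s = 0%M by rewrite /G mexp_orbit_start; mring.
have dG : mderiv_at G s 0.
  have := mderiv_add dPhi (mderiv_opp (mderiv_mexp_orbit A s (Phi s) s)).
  by congr mderiv_at; rewrite mexp_orbit_start; mring.
have [d [d_gt0 expansion]] := mderiv_at_expansion dG eps_gt0.
exists d; split=> // u /expansion; rewrite -/(G u) Gs (_ : G u - 0 - _ = G u)%M //; mring.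
Qed.

Section Approximation.
Variables (n : nat) (M : mat n -> Prop) (b t : R) (sigma Phi : R -> mat n).
Hypotheses (M_le : opnorm_bounded b M) (t_ge0 : 0 <= t).
Hypothesis sigma_in : forall s, 0 <= s <= t -> M (sigma s).

Let M_nonempty : nonempty M.
Proof. by exists (sigma 0); apply: sigma_in; lra. Qed.

Let b_ge0 : 0 <= b.
Proof. by have [A /M_le A_le] := M_nonempty; exact: Rle_trans (opnorm_ge0 A) A_le. Qed.

Let exp_mono x y : x <= y -> exp (b * x) <= exp (b * y).
Proof. by move=> xy; apply: exp_le; exact: Rmult_le_compat_l. Qed.

Let exp_ge1 x : 0 <= x -> 1 <= exp (b * x).
Proof. by move=> x_ge0; have := exp_mono x_ge0; rewrite Rmult_0_r exp_0. Qed.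

(* The slope of [gap] is nonpositive wherever [Phi] solves the equation, since there [Phi]
   agrees to first order with the exponential of the frozen matrix [sigma s]. *)
Definition gap x := exp (- (b * x)) * opdist (Phi x) (exp_St M x).

Lemma gap_mul_exp x : gap x * exp (b * x) = opdist (Phi x) (exp_St M x).
Proof. by rewrite /gap Rmult_comm -Rmult_assoc -exp_plus Rplus_opp_r exp_0 Rmult_1_l. Qed.

Lemma gap_le_add A x y r : 0 <= x <= y -> M A -> 0 <= r ->
  (forall Y, exp_St M x Y -> opnorm (Phi y - mexp ((y - x) *: A) * Y) <=
    exp (b * (y - x)) * opnorm (Phi x - Y) + r) -> gap y <= gap x + r.
Proof.
move=> [x_ge0 xy] MA r_ge0 transport_le.
have [yx_ge0 y_ge0] : 0 <= y - x /\ 0 <= y by lra.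
suff : (gap y - r) * exp (b * x) <= gap x * exp (b * x).
  by move/(Rmult_le_reg_r _ _ _ (exp_pos _)); lra.
rewrite gap_mul_exp.
apply: (opdist_is_glb _ (exp_St_nonempty x_ge0 M_nonempty)).2 => Y MY.
have dist_y_le : gap y * exp (b * y) <= exp (b * (y - x)) * opnorm (Phi x - Y) + r.
  rewrite gap_mul_exp; apply: Rle_trans (transport_le Y MY).
  apply: (opdist_is_glb _ (exp_St_nonempty y_ge0 M_nonempty)).1.
  by have := exp_St_cons yx_ge0 MA MY; rewrite (_ : y - x + x = y) //; ring.
apply: (Rmult_le_reg_l (exp (b * (y - x)))); first exact: exp_pos.
rewrite (_ : _ * (_ * exp (b * x)) = (gap y - r) * exp (b * y)); last first.
  by rewrite (_ : b * y = b * (y - x) + b * x) ?exp_plus; ring.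
by have := Rmult_le_compat_l _ _ _ r_ge0 (exp_ge1 y_ge0); lra.
Qed.

Lemma gap_increment_le x y : 0 <= x -> x <= y -> y <= t ->
  gap y - gap x <= opnorm (Phi y - Phi x) + exp (b * t) * b * (y - x).
Proof.
move=> x_ge0 xy yt; have MA : M (sigma x) by apply: sigma_in; lra.
have yx_ge0 : 0 <= y - x by lra.
suff : gap y <= gap x + (opnorm (Phi y - Phi x) + exp (b * t) * b * (y - x)) by lra.
apply: (gap_le_add (conj x_ge0 xy) MA).
  by apply: Rplus_le_le_0_compat => //; do 2 apply: Rmult_le_pos => //.
move=> Y MY; set E := mexp _.
rewrite (_ : Phi y - E * Y = (Phi x - Y) + ((Phi y - Phi x) - (E - 1) * Y))%M; last first.
  by rewrite mmulBl mmul1m; mring.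
apply: Rle_trans (opnorm_triangle _ _) _; apply: Rplus_le_compat.
  by rewrite -[X in X <= _]Rmult_1_l; apply: Rmult_le_compat_r => //; exact: exp_ge1.
apply: Rle_trans (opnorm_triangle _ _) _; rewrite opnormN; apply: Rplus_le_compat_l.
have E_le : opnorm (E - 1) <= exp (b * (y - x)) * (b * (y - x)).
  apply: opnorm_mexp_sub1; rewrite opnormZ Rabs_pos_eq // Rmult_comm.
  by apply: Rmult_le_compat_r => //; exact: M_le.
apply: Rle_trans (opnorm_mul _ _) _.
apply: Rle_trans (_ : exp (b * (y - x)) * (b * (y - x)) * exp (b * x) <= _).
  by apply: Rmult_le_compat => //; exact: (opnorm_exp_St M_le MY).
rewrite (_ : _ * _ * exp (b * x) = exp (b * y) * (b * (y - x))); last first.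
  by rewrite (_ : b * y = b * (y - x) + b * x) ?exp_plus; ring.
rewrite Rmult_assoc; apply: Rmult_le_compat_r; last exact: exp_mono.
exact: Rmult_le_pos.
Qed.

Lemma abs_cont_above_gap : abs_cont_on Phi t -> abs_cont_above gap t.
Proof.
move=> Phi_ac eps eps_gt0; set C := exp (b * t) * b.
have C_ge0 : 0 <= C by apply: Rmult_le_pos.
have n_ge0 := pos_INR n.
have [|delta [delta_gt0 Phi_small]] := Phi_ac (eps / 2 / (INR n + 1)).
  by apply: Rdiv_lt_0_compat; lra.
have quot_gt0 : 0 < eps / 2 / (C + 1) by apply: Rdiv_lt_0_compat; lra.
exists (Rmin delta (eps / 2 / (C + 1))); split; first exact: Rmin_pos.
move=> m a a' [intervals ordered] len_lt.
have [min_delta min_quot] := (Rmin_l delta (eps / 2 / (C + 1)), Rmin_r delta (eps / 2 / (C + 1))).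
set len := \rsum_(k < m) (a' k - a k) in len_lt *.
have len_lt_delta : len < delta by lra.
have := Phi_small m a a' intervals ordered len_lt_delta.
set var := \rsum_(k < m) mdist _ _ => var_lt.
have increments_le : \rsum_(k < m) (gap (a' k) - gap (a k)) <= INR n * var + C * len.
  rewrite /var /len !big_distrr -big_split; apply: rsum_le => k /=.
  have [ak_ge0 [ak_le a'k_le]] := intervals k (ltn_ord k).
  have := gap_increment_le ak_ge0 ak_le a'k_le.
  by have := opnorm_le_mnorm (Phi (a' k) - Phi (a k)); rewrite -/(mdist _ _) -/C; lra.
have len_part : C * len <= eps / 2.
  rewrite (_ : eps / 2 = (C + 1) * (eps / 2 / (C + 1))); last by field; lra.
  apply: Rle_trans (_ : C * (eps / 2 / (C + 1)) <= _); last by lra.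
  by apply: Rmult_le_compat_l; lra.
have var_part : INR n * var < eps / 2.
  rewrite (_ : eps / 2 = (INR n + 1) * (eps / 2 / (INR n + 1))); last by field; lra.
  have := Rmult_le_compat_l _ _ _ n_ge0 (Rlt_le _ _ var_lt).
  by have : 0 < eps / 2 / (INR n + 1) by [apply: Rdiv_lt_0_compat; lra]; lra.
lra.
Qed.

Lemma slope_nonpos_gap s : 0 <= s <= t -> mderiv_at Phi s (sigma s * Phi s)%M ->
  slope_nonpos gap t s.
Proof.
move=> s_in dPhi eps eps_gt0; set A := sigma s in dPhi.
have A_le : opnorm A <= b by apply: M_le; exact: sigma_in.
have exp_t_gt0 := exp_pos (b * t); have exp_t_ge1 := exp_ge1 t_ge0.
pose eps' := eps / exp (b * t); have eps'_gt0 : 0 < eps' by exact: Rdiv_lt_0_compat.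
have [d [d_gt0 expansion]] := mderiv_at_exp_expansion dPhi eps'_gt0.
pose G u := (Phi u - mexp_orbit A s (Phi s) u)%M.
exists d; split=> // x y x_in y_in sx ys.
suff : gap y <= gap x + eps * (y - x) by lra.
have [x_ge0 yx_ge0] : 0 <= x /\ 0 <= y - x by lra.
apply: (gap_le_add (A := A)); [lra|exact: sigma_in|by apply: Rmult_le_pos; lra|].
move=> Y MY; set E := mexp _.
have E_le : opnorm E <= exp (b * (y - x)) by exact: opnorm_mexpZ_le.
rewrite (_ : Phi y - E * Y = E * (Phi x - Y) + (G y - E * G x))%M; last first.
  rewrite /G !mmulBr (mmulA E) -mexpD (_ : y - x + (x - s) = y - s); last by ring.
  rewrite -/(mexp_orbit A s (Phi s) y).
  by mring.
apply: Rle_trans (opnorm_triangle _ _) _; apply: Rplus_le_compat.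
  by apply: Rle_trans (opnorm_mul _ _) _; exact: Rmult_le_compat_r.
apply: Rle_trans (opnorm_triangle _ _) _; rewrite opnormN.
have Gx_le : opnorm (G x) <= eps' * (s - x).
  by have := expansion x; rewrite Rabs_minus_sym Rabs_pos_eq; [apply|]; lra.
have Gy_le : opnorm (G y) <= eps' * (y - s).
  by have := expansion y; rewrite Rabs_pos_eq; [apply|]; lra.
have EGx_le : opnorm (E * G x) <= exp (b * t) * (eps' * (s - x)).
  apply: Rle_trans (opnorm_mul _ _) _; apply: Rmult_le_compat => //.
  by apply: Rle_trans E_le _; apply: exp_mono; lra.
have eps_ys_ge0 : 0 <= eps' * (y - s) by apply: Rmult_le_pos; lra.
have := Rmult_le_compat_r _ _ _ eps_ys_ge0 exp_t_ge1.
have : eps * (y - x) = exp (b * t) * (eps' * (y - x)) by rewrite /eps'; field; lra.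
lra.
Qed.

Lemma gap_end_le0 : Phi 0 = 1%M -> abs_cont_on Phi t ->
  null_set (fun s => 0 < s < t /\ ~ mderiv_at Phi s (sigma s * Phi s)%M) -> gap t <= 0.
Proof.
move=> Phi0 Phi_ac exceptional_null; apply: (Rle_trans _ (gap 0)).
  apply: ae_slope_nonpos_le => //; first exact: abs_cont_above_gap.
  apply: null_set_sub exceptional_null => s [s_in no_slope]; split=> // dPhi.
  by apply: no_slope; apply: slope_nonpos_gap => //; lra.
rewrite /gap Rmult_0_r Ropp_0 exp_0 Rmult_1_l Phi0.
have exp_St0 : nonempty (exp_St M 0) by exists 1%M; exact: exp_St_nil.
by apply: Rle_trans ((opdist_is_glb _ exp_St0).1 _ (exp_St_nil M)) _; rewrite opnorm_subxx; lra.
Qed.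

End Approximation.

Lemma cont_St_within n (M : mat n -> Prop) b t eps : opnorm_bounded b M -> 0 <= t ->
  0 < eps -> within eps (cont_St M t) (exp_St M t).
Proof.
move=> M_le t_ge0 eps_gt0 X [sigma [Phi [sigma_in [Phi0 [Phi_ac [exceptional_null ->]]]]]].
have M_nonempty : nonempty M by exists (sigma 0); apply: sigma_in; lra.
have gap_le0 := gap_end_le0 M_le t_ge0 sigma_in Phi0 Phi_ac exceptional_null.
apply: NNPP => no_Y.
have : eps <= opdist (Phi t) (exp_St M t).
  apply: (opdist_is_glb _ (exp_St_nonempty t_ge0 M_nonempty)).2 => Y MY.
  by apply: Rnot_lt_le => lt_eps; apply: no_Y; exists Y; split=> //; lra.
rewrite -(gap_mul_exp M b Phi t).
by have := Rmult_le_compat_r _ _ _ (exp_ge0 (b * t)) gap_le0; lra.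
Qed.

(** * The continuous joint spectral radius *)

Lemma Rpower_le_exp q u c : Rabs u <= c -> Rpower q u <= exp (Rabs (ln q) * c).
Proof.
move=> u_le; apply: exp_le; have := Rle_abs (u * ln q); rewrite Rabs_mult.
by have := Rmult_le_compat_r _ _ _ (Rabs_pos (ln q)) u_le; lra.
Qed.

Lemma exp_pow x k : exp x ^ k = exp (INR k * x).
Proof. by rewrite -Rpower_pow ?/Rpower ?ln_exp //; exact: exp_pos. Qed.

Lemma Rpower_pow_mul q t k : Rpower q t ^ k = Rpower q (INR k * t).
Proof. by rewrite /Rpower exp_pow Rmult_assoc. Qed.

Lemma Rpower_le_add a b p h x y : 0 < a -> 0 <= p -> 0 <= h -> a <= x <= b -> a <= y ->
  x <= y + h -> Rpower x p <= Rpower y p + Rpower b p * p / a * h.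
Proof.
move=> a_gt0 p_ge0 h_ge0 [ax xb] ay xy.
have ratio_gt0 : 0 < x / y by apply: Rdiv_lt_0_compat; lra.
have ln_sub_le : ln x - ln y <= h / a.
  have -> : ln x - ln y = ln (x / y).
    rewrite /Rdiv ln_mult ?ln_Rinv; [lra|lra|lra|].
    by apply: Rinv_0_lt_compat; lra.
  have := exp_ineq1_le (ln (x / y)); rewrite exp_ln // => ln_le_ratio.
  have : x / y <= 1 + h / a; last lra.
  apply: Rle_trans (_ : (y + h) / y <= _).
    by apply: Rmult_le_compat_r; [apply: Rinv_ge0; lra|].
  rewrite (_ : (y + h) / y = 1 + h / y); last by field; lra.
  by apply: Rplus_le_compat_l; apply: Rmult_le_compat_l => //; apply: Rinv_le_contravar; lra.
have x_pow_gt0 : 0 < Rpower x p := exp_pos _.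
have y_pow_ge : Rpower x p * (1 + p * (ln y - ln x)) <= Rpower y p.
  rewrite (_ : Rpower y p = Rpower x p * exp (p * (ln y - ln x))); last first.
    by rewrite /Rpower -exp_plus; congr exp; ring.
  by apply: Rmult_le_compat_l; [lra|exact: exp_ineq1_le].
have p_ln_le := Rmult_le_compat_l _ _ _ p_ge0 ln_sub_le.
have pha_ge0 : 0 <= p * (h / a) by apply: Rmult_le_pos => //; exact: Rdiv_le_0_compat.
have x_pow_le : Rpower x p * (p * (h / a)) <= Rpower b p * (p * (h / a)).
  by apply: Rmult_le_compat_r => //; apply: Rle_Rpower_l; lra.
have := Rmult_le_compat_l _ _ _ (Rlt_le _ _ x_pow_gt0) p_ln_le.
rewrite (_ : _ * p / a * h = Rpower b p * (p * (h / a))); last by field; lra.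
lra.
Qed.

Section ContinuousGrowth.
Variables (n : nat) (N : mat n -> Prop) (b t0 : R).
Hypotheses (N_nonempty : nonempty N) (b_ge0 : 0 <= b) (N_le : opnorm_bounded b N).
Hypothesis t0_gt0 : 0 < t0.

Lemma opnorm_bounded_cont_St t c : 0 <= t ->
  opnorm_bounded c (exp_St N t) -> opnorm_bounded c (cont_St N t).
Proof.
move=> t_ge0 St_le X NX; apply: le_epsilon => eps eps_gt0.
have [Y [/St_le Y_le XY]] := cont_St_within N_le t_ge0 eps_gt0 NX.
by have := opnorm_le_sub X Y; lra.
Qed.

Lemma time_split t : 0 <= t -> exists k s, t = INR k * t0 + s /\ 0 <= s < t0.
Proof.
move=> t_ge0; have [|k [k_le k_gt]] := nfloor_ex (t / t0); first exact: Rdiv_le_0_compat.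
have t_eq : t = t / t0 * t0 by field; lra.
exists k, (t - INR k * t0); split; first ring.
have := Rmult_le_compat_r _ _ _ (Rlt_le _ _ t0_gt0) k_le.
by have := Rmult_lt_compat_r _ _ _ t0_gt0 k_gt; lra.
Qed.

Lemma opnorm_exp_St_period s X : s <= t0 -> exp_St N s X -> opnorm X <= exp (b * t0).
Proof.
move=> s_le NX; apply: Rle_trans (opnorm_exp_St N_le NX) _.
by apply: exp_le; exact: Rmult_le_compat_l.
Qed.

Lemma opnorm_bounded_period : opnorm_bounded (exp (b * t0)) (exp_St N t0).
Proof. by move=> X; apply: opnorm_exp_St_period; lra. Qed.

Variable rho : R.
Hypothesis rate : growth_rate (exp_St N t0) rho.

Lemma exp_St_growth_le q : rho < Rpower q t0 -> exists C, forall t, 0 <= t ->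
  opnorm_bounded (C * Rpower q t) (exp_St N t).
Proof.
move=> rho_q; have [C [C_ge0 X_le]] := rate.2.1 _ rho_q.
set E := exp (b * t0); set D := exp (Rabs (ln q) * t0).
exists (C * E * D) => t t_ge0 X; have [k [s [-> s_in]]] := time_split t_ge0.
have kt0_ge0 : 0 <= INR k * t0 by apply: Rmult_le_pos => //; lra.
move=> /(exp_St_split kt0_ge0 s_in.1)[Y [Z [NY [NZ ->]]]].
have Y_le : opnorm Y <= C * Rpower q (INR k * t0).
  by rewrite -Rpower_pow_mul; apply: X_le; apply/disc_St_exp_St => //; lra.
have Z_le : opnorm Z <= E by apply: opnorm_exp_St_period NZ; lra.
have shift_le : Rpower q (INR k * t0) <= D * Rpower q (INR k * t0 + s).
  rewrite {1}(_ : INR k * t0 = - s + (INR k * t0 + s)); last by ring.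
  rewrite Rpower_plus; apply: Rmult_le_compat_r; first exact: exp_ge0.
  by apply: Rpower_le_exp; rewrite Rabs_Ropp Rabs_pos_eq; lra.
apply: Rle_trans (opnorm_mul _ _) _.
apply: Rle_trans (_ : C * Rpower q (INR k * t0) * E <= _); first exact: Rmult_le_compat.
rewrite (_ : _ * E * D * _ = C * E * (D * Rpower q (INR k * t0 + s))); last by ring.
rewrite (_ : _ * _ * E = C * E * Rpower q (INR k * t0)); last by ring.
apply: Rmult_le_compat_l => //; apply: Rmult_le_pos => //; exact: exp_ge0.
Qed.

Lemma exp_St_growth_ge q : Rpower q t0 < rho -> exists C, 0 < C /\ forall t, 0 <= t ->
  exists X, exp_St N t X /\ Rpower q t <= C * opnorm X.
Proof.
move=> q_rho; set E := exp (b * t0); set D := exp (Rabs (ln q) * t0).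
have [E_gt0 D_gt0] : 0 < E /\ 0 < D by split; exact: exp_pos.
exists (D * E); split=> [|t t_ge0]; first exact: Rmult_lt_0_compat.
have [k [s [t_eq s_in]]] := time_split t_ge0.
have [X [NX X_ge]] := growth_rate_witness (Rlt_le _ _ E_gt0) opnorm_bounded_period rate
  (ltn0Sn k) (conj (exp_pos _) q_rho).
have end_eq : INR k.+1 * t0 = t + (t0 - s) by rewrite S_INR t_eq; ring.
move/(disc_St_exp_St _ _ _ (Rlt_le _ _ t0_gt0)): NX; rewrite end_eq.
have rest_ge0 : 0 <= t0 - s by lra.
move=> /(exp_St_split t_ge0 rest_ge0)[Y [Z [NY [NZ X_eq]]]]; exists Y; split=> //.
have Z_le : opnorm Z <= E by apply: opnorm_exp_St_period NZ; lra.
have X_le : opnorm X <= E * opnorm Y.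
  rewrite X_eq Rmult_comm; apply: Rle_trans (opnorm_mul _ _) _; exact: Rmult_le_compat_l.
have shift_le : Rpower q t <= D * Rpower q (INR k.+1 * t0).
  rewrite {1}(_ : t = (s - t0) + INR k.+1 * t0); last by rewrite end_eq; ring.
  rewrite Rpower_plus; apply: Rmult_le_compat_r; first exact: exp_ge0.
  by apply: Rpower_le_exp; rewrite Rabs_left1; lra.
rewrite -Rpower_pow_mul in shift_le; apply: Rle_trans shift_le _; rewrite Rmult_assoc.
by apply: Rmult_le_compat_l; [lra|exact: Rle_trans X_ge X_le].
Qed.

Lemma growth_rate_exp_St_ge : (0 < n)%N -> exp (- (b * t0)) <= rho.
Proof.
move=> n_gt0; have [A NA] := N_nonempty.
apply: growth_rate_ge rate (exp_pos _) _ => k; have k_ge0 := pos_INR k.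
have kt0_ge0 : 0 <= INR k * t0 by apply: Rmult_le_pos => //; lra.
exists (mexp ((INR k * t0) *: A)); split.
  by apply/disc_St_exp_St; [lra|exact: exp_St_exp].
rewrite exp_pow; set X := mexp ((INR k * t0) *: A).
have inverse_le : opnorm (mexp ((- (INR k * t0)) *: A)) <= exp (b * (INR k * t0)).
  apply: Rle_trans (opnorm_mexp _) _; apply: exp_le.
  rewrite opnormZ Rabs_Ropp Rabs_pos_eq // Rmult_comm; apply: Rmult_le_compat_r => //.
  exact: N_le.
apply: (Rmult_le_reg_l (exp (b * (INR k * t0)))); first exact: exp_pos.
rewrite -exp_plus (_ : _ + INR k * _ = 0) ?exp_0; last by ring.
apply: Rle_trans (opnorm1_ge1 n_gt0) _; rewrite -(mexpNK A (INR k * t0)).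
by apply: Rle_trans (opnorm_mul _ _) _; exact: Rmult_le_compat_r.
Qed.

Lemma jsr_cont_growth_rate : 0 < rho -> jsr_cont N = Rpower rho (/ t0).
Proof.
move=> rho_gt0; set r := Rpower rho (/ t0); have r_gt0 : 0 < r := exp_pos _.
have r_pow : Rpower r t0 = rho by rewrite Rpower_mult Rinv_l ?Rpower_1; lra.
pose G t x := 0 <= t /\ x = sup_norm (cont_St N t).
have growth : exponential_growth G r.
  split; [lra|split] => [q rq|q qr].
    have [|C St_le] := @exp_St_growth_le q; first by rewrite -r_pow; apply: Rlt_Rpower_l; lra.
    exists C => t x [t_ge0 ->]; apply: sup_norm_le.
      have [X NX] := exp_St_nonempty t_ge0 N_nonempty.
      by exists X; exact: exp_St_cont_St.
    by apply: opnorm_bounded_cont_St => //; exact: St_le.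
  have [|C [C_gt0 X_ge]] := @exp_St_growth_ge q; first by rewrite -r_pow; apply: Rlt_Rpower_l; lra.
  have n_ge0 := pos_INR n.
  exists (C * (INR n + 1)); split=> [|t x [t_ge0 ->]]; first by apply: Rmult_lt_0_compat; lra.
  have [X [NX X_pow]] := X_ge t t_ge0; apply: Rle_trans X_pow _; rewrite Rmult_assoc.
  apply: Rmult_le_compat_l; first lra.
  apply: opnorm_le_sup_norm (exp_St_cont_St N_nonempty NX).
  exact: opnorm_bounded_cont_St t_ge0 (opnorm_exp_St N_le).
pose converges x := forall eps, 0 < eps -> exists T, forall t, T <= t ->
  Rabs (root_t (sup_norm (cont_St N t)) t - x) < eps.
have cvg_r : converges r.
  move=> eps eps_gt0; have [T root_near] := root_t_cvg growth eps_gt0.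
  exists (Rmax 0 T) => t t_ge; apply: root_near.
    exact: Rle_trans (Rmax_r _ _) t_ge.
  by split=> //; exact: Rle_trans (Rmax_l _ _) t_ge.
have cvg_jsr : converges (jsr_cont N) := epsilon_spec (inhabits 0) _ (ex_intro converges r cvg_r).
have cvg_nat x : converges x -> Un_cv (fun k => root_t (sup_norm (cont_St N (INR k))) (INR k)) x.
  move=> cvg eps /cvg[T near]; have [k k_gt] := INR_unbounded T; exists k => j j_ge.
  by apply: near; apply: Rle_trans (Rlt_le _ _ k_gt) _; exact: le_INR.
exact: UL_sequence (cvg_nat _ cvg_jsr) (cvg_nat _ cvg_r).
Qed.

End ContinuousGrowth.

Lemma jsr_cont_root n (N : mat n -> Prop) b t : (0 < n)%N -> nonempty N -> 0 <= b ->
  opnorm_bounded b N -> 0 < t -> exists rho, growth_rate (exp_St N t) rho /\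
  exp (- (b * t)) <= rho <= exp (b * t) /\ jsr_cont N = Rpower rho (/ t).
Proof.
move=> n_gt0 N_nonempty b_ge0 N_le t_gt0.
have St_le := opnorm_bounded_period b_ge0 N_le (t0 := t).
have exp_gt0 := exp_pos (- (b * t)).
have [rho rate] := growth_rate_exists (exp_ge0 _) St_le.
have rho_ge := growth_rate_exp_St_ge N_nonempty N_le t_gt0 rate n_gt0.
exists rho; split=> //; split; first by split=> //; exact: growth_rate_le_opnorm St_le rate.
by apply: (jsr_cont_growth_rate N_nonempty b_ge0 N_le t_gt0 rate); lra.
Qed.

Lemma exp_St_near n (M : mat n -> Prop) b t delta : 0 <= b -> opnorm_bounded b M -> 0 < t ->
  0 < delta -> exists delta', 0 < delta' /\ forall N, mutually_within delta' M N ->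
  opnorm_bounded (b + 1) N /\ within delta (cont_St M t) (exp_St N t).
Proof.
move=> b_ge0 M_le t_gt0 delta_gt0; set D := t * exp ((b + 1) * t).
have D_gt0 : 0 < D by apply: Rmult_lt_0_compat => //; exact: exp_pos.
have quot_gt0 : 0 < delta / 2 / D by apply: Rdiv_lt_0_compat; lra.
have M_le1 : opnorm_bounded (b + 1) M by move=> A /M_le; lra.
have [min1 min_quot] := (Rmin_l 1 (delta / 2 / D), Rmin_r 1 (delta / 2 / D)).
set delta' := Rmin 1 (delta / 2 / D) in min1 min_quot *.
have delta'_gt0 : 0 < delta' by apply: Rmin_pos; lra.
exists delta'; split=> // N [MN NM].
have N_le : opnorm_bounded (b + 1) N.
  by move=> A /(opnorm_bounded_within M_le NM); lra.
split=> // X /(cont_St_within M_le1 (Rlt_le _ _ t_gt0) (eps := delta / 2)) approx.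
have [|Y [MY XY]] := approx; first lra.
have [Z [NZ YZ]] := exp_St_within M_le1 N_le (Rlt_le _ _ delta'_gt0) MN MY.
exists Z; split=> //; apply: Rle_trans (opnorm_sub_triangle Y _ _) _.
have : D * delta' <= delta / 2; last by rewrite /D in YZ *; lra.
rewrite (_ : delta / 2 = D * (delta / 2 / D)); last by field; lra.
by apply: Rmult_le_compat_l; lra.
Qed.

Lemma nonempty_sets_eq_dim0 n (N1 N2 : mat n -> Prop) : n = 0%N ->
  nonempty N1 -> nonempty N2 -> N1 = N2.
Proof.
move=> n0 [A1 NA1] [A2 NA2].
have mat_eq (A B : mat n) : A = B.
  by apply: functional_extensionality => i; have := ltn_ord i; rewrite {2}n0.
apply: functional_extensionality => A; apply: propositional_extensionality.
by rewrite {1}(mat_eq A A1) (mat_eq A A2).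
Qed.

Lemma growth_rate_exp_St_lipschitz n (K : vec n -> Prop) (M : mat n -> Prop) B b t :
  proper_cone K -> 0 <= b -> opnorm_bounded b M -> 0 < t ->
  mconv (cont_St M t) B -> K_irreducible K B ->
  exists delta L, 0 < delta /\ 0 <= L /\ forall N1 N2 h rho1 rho2,
    (forall A, N2 A -> in_pi_exp K A) -> mutually_within delta M N1 ->
    mutually_within delta M N2 -> 0 <= h -> within h N1 N2 ->
    growth_rate (exp_St N1 t) rho1 -> growth_rate (exp_St N2 t) rho2 -> rho1 <= rho2 + L * h.
Proof.
move=> K_proper b_ge0 M_le t_gt0 MB irr.
set E := exp ((b + 1) * t); have E_ge0 : 0 <= E := exp_ge0 _.
have [delta [L [delta_gt0 [L_ge0 lipschitz]]]] := growth_rate_lipschitz K_proper MB irr E_ge0.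
have [delta' [delta'_gt0 near_M]] := exp_St_near b_ge0 M_le t_gt0 delta_gt0.
have tE_ge0 := Rmult_le_pos _ _ (Rlt_le _ _ t_gt0) E_ge0.
exists delta', (L * (t * E)); split=> //; split; first exact: Rmult_le_pos.
move=> N1 N2 h rho1 rho2 N2_pos /near_M[N1_le _] /near_M[N2_le MN2] h_ge0 N12 rate1 rate2.
rewrite Rmult_assoc; apply: lipschitz MN2 _ _ rate1 rate2.
- by move=> X; exact: exp_St_in_pi.
- exact: opnorm_exp_St.
- exact: Rmult_le_pos.
- exact: exp_St_within.
Qed.

Lemma loc_lipschitz_jsr_cont n (K : vec n -> Prop) :
  proper_cone K -> loc_lipschitz (P_cont K) (@jsr_cont n).
Proof.
move=> K_proper; apply: loc_lipschitz_of_within => M [_ [M_compact [M_nonempty irr_conv]]].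
  by have [b [_ M_le]] := mcompact_opnorm_bounded M_compact; split=> //; exists b.
have [n_eq0|n_gt0] := posnP n.
  exists 1, 0; do 2 (split; first lra).
  move=> N1 N2 h [_ [_ [N1_nonempty _]]] [_ [_ [N2_nonempty _]]] _ _ _ _.
  by rewrite (nonempty_sets_eq_dim0 n_eq0 N1_nonempty N2_nonempty); lra.
have [b [b_ge0 M_le]] := mcompact_opnorm_bounded M_compact.
have [t [t_gt0 [B [MB irr]]]] := irr_conv; have b1_ge0 : 0 <= b + 1 by lra.
have inv_t_ge0 := Rinv_ge0 t_gt0.
have [delta [L [delta_gt0 [L_ge0 lipschitz]]]] :=
  growth_rate_exp_St_lipschitz K_proper b_ge0 M_le t_gt0 MB irr.
have min_gt0 : 0 < Rmin delta 1 by apply: Rmin_pos; lra.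
set E := exp ((b + 1) * t); set a := exp (- ((b + 1) * t)); have a_gt0 : 0 < a := exp_pos _.
exists (Rmin delta 1), (Rpower E (/ t) * / t / a * L); split=> //; split.
  apply: Rmult_le_pos => //; apply: Rdiv_le_0_compat => //; apply: Rmult_le_pos => //.
  exact: exp_ge0.
have root N : P_cont K N -> mutually_within (Rmin delta 1) M N -> exists rho,
    growth_rate (exp_St N t) rho /\ a <= rho <= E /\ jsr_cont N = Rpower rho (/ t).
  move=> [_ [_ [N_nonempty _]]] /(mutually_within_le (Rmin_r _ _))[_ NM].
  exact: jsr_cont_root (opnorm_bounded_within M_le NM) t_gt0.
move=> N1 N2 h PN1 PN2 MN1 MN2 h_ge0 [N12 _].
have [rho1 [rate1 [rho1_in ->]]] := root N1 PN1 MN1.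
have [rho2 [rate2 [rho2_in ->]]] := root N2 PN2 MN2.
have Lh_ge0 := Rmult_le_pos _ _ L_ge0 h_ge0.
rewrite Rmult_assoc; apply: Rpower_le_add => //; first exact: rho2_in.1.
apply: lipschitz rate1 rate2 => //; first exact: PN2.1.
  exact: mutually_within_le (Rmin_l _ _) MN1.
exact: mutually_within_le (Rmin_l _ _) MN2.
Qed.

Theorem mainTheorem10 (n : nat) (K : vec n -> Prop) :
  proper_cone K ->
  loc_lipschitz (P_disc K) (@jsr_disc n) /\ loc_lipschitz (P_cont K) (@jsr_cont n).
Proof.
by move=> K_proper; split; [exact: loc_lipschitz_jsr_disc|exact: loc_lipschitz_jsr_cont].
Qed.
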